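(* Let $n,p\ge 1$ be integers with $n-p-1>0$. Then the Efron--Morris estimator $$\hat{M}_{\mathrm{EM}}(X) = X\left(I_p-(n-p-1)(X^{\top}X)^{-1}\right)$$ of the mean matrix $M$, based on $X\sim \mathrm{N}_{n,p}(M,I_n,I_p)$, is minimax under the matrix quadratic loss.
   Context: $X\sim \mathrm{N}_{n,p}(M,I_n,I_p)$ means that $X\in\mathbb{R}^{n\times p}$ has independent entries $X_{ai}\sim \mathrm{N}(M_{ai},1)$, where $M\in\mathbb{R}^{n\times p}$ is unknown; $\mathrm{E}_M$ is expectation under this law. ($X^\top X$ is invertible almost surely, so $\hat M_{\mathrm{EM}}$ is defined almost surely.) An estimator is a measurable function $\hat M=\hat M(X)\in\mathbb{R}^{n\times p}$. The matrix quadratic loss is $L(M,\hat M)=(\hat M-M)^\top(\hat M-M)$ and the risk is $R(M,\hat M)=\mathrm{E}_M[L(M,\hat M(X))]$, so that $c^\top R(M,\hat M)c=\mathrm{E}_M[\|\hat Mc-Mc\|^2]\in[0,\infty]$ for $c\in\mathbb{R}^p$. An estimator $\hat M$ is minimax under the matrix quadratic loss if, for every $c\in\mathbb{R}^p$, $\sup_M c^\top R(M,\hat M)c=\inf_{\hat M'}\sup_M c^\top R(M,\hat M')c$, the infimum being over all estimators $\hat M'$ and the suprema over all $M\in\mathbb{R}^{n\times p}$. *)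

(* Defs.v *)
From HB Require Import structures.
From mathcomp Require Import all_boot all_order all_algebra.
From mathcomp Require Import all_classical all_reals all_analysis.

Set Implicit Arguments.
Unset Strict Implicit.
Unset Printing Implicit Defensive.

Import Order.TTheory GRing.Theory Num.Theory.
Import numFieldNormedType.Exports.

Local Open Scope classical_set_scope.
Local Open Scope ring_scope.

(* The Borel sigma-algebra of R^{n x p}, generated by the entry maps. *)
Definition measure_matrix_display : measure_display.
Proof. exact: default_measure_display. Qed.

Section measurable_matrix.
Context {R : realType} {n p : nat}.

Definition mx_entry (ij : 'I_n * 'I_p) (A : 'M[R]_(n, p)) : R := A ij.1 ij.2.

Definition mx_cylinders : set (set 'M[R]_(n, p)) :=
  [set C | exists ij B, measurable B /\ C = mx_entry ij @^-1` B].

HB.instance Definition _ := @isMeasurable.Build measure_matrix_display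
  'M[R]_(n, p) <<s mx_cylinders >> (@sigma_algebra0 _ setT mx_cylinders)
  (@sigma_algebraC _ mx_cylinders) (@sigma_algebra_bigcup _ setT mx_cylinders).

Lemma measurable_mx_entry (ij : 'I_n * 'I_p) :
  measurable_fun [set: 'M[R]_(n, p)] (mx_entry ij).
Proof.
move=> _ B mB; rewrite setTI; apply: sub_sigma_algebra.
by exists ij, B.
Qed.

HB.instance Definition _ ij :=
  isMeasurableFun.Build _ _ _ _ (mx_entry ij) (measurable_mx_entry ij).

Lemma measurable_fun_mxP d (T : measurableType d) (f : T -> 'M[R]_(n, p)) :
  (forall ij, measurable_fun setT (mx_entry ij \o f)) -> measurable_fun setT f.
Proof.
move=> mf; apply: (@measurability _ _ _ _ _ _ mx_cylinders) => //.
move=> _ [_ [ij [B [mB ->]]] <-].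
by rewrite -comp_preimage; exact: mf.
Qed.

End measurable_matrix.

Section model.
Context {d : measure_display} {T : measurableType d} {R : realType}.

Definition mutually_independent {d'} {T' : measurableType d'} (P : probability T R)
    (I : finType) (X : I -> {RV P >-> T'}) : Prop :=
  forall (J : {set I}) (B : I -> set T'), (forall i, measurable (B i)) ->
    P (\bigcap_(i in [set` J]) (X i @^-1` B i)) =
    (\prod_(i in J) P (X i @^-1` B i))%E.

Definition matrix_normal {n p : nat} (P : probability T R)
    (X : {RV P >-> 'M[R]_(n, p)}) (M : 'M[R]_(n, p)) : Prop :=
  mutually_independent (fun ij => (mx_entry ij \o X : {RV P >-> R})) /\
  forall i j (B : set R), measurable B ->
    distribution P (mx_entry (i, j) \o X : {RV P >-> R}) B =
    normal_prob (M i j) 1 B.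

End model.

Section minimaxity.
Context {R : realType} {n p : nat}.

Definition mx_quadratic_loss (M Mhat : 'M[R]_(n, p)) : 'M[R]_p :=
  (Mhat - M)^T *m (Mhat - M).

(* invmx A = A when A is singular; under the normal model X^T X is almost surely
   invertible, so this convention does not affect the risk. *)
Definition efron_morris (X : 'M[R]_(n, p)) : 'M[R]_(n, p) :=
  X *m (1%:M - (n%:R - p%:R - 1) *: invmx (X^T *m X)).

Context {d : measure_display} {T : measurableType d}.
Variables (P : 'M[R]_(n, p) -> probability T R) (X : T -> 'M[R]_(n, p)).

(* The quadratic form c^T R(M, delta) c of the risk matrix, as a \bar R-valued
   expectation; the entries of R(M, delta) themselves need not be defined when
   the loss is not integrable. *)
Definition quadratic_risk (M : 'M[R]_(n, p)) (delta : 'M[R]_(n, p) -> 'M[R]_(n, p))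
    (c : 'cV[R]_p) : \bar R :=
  ('E_(P M)[fun w =>
    (c^T *m mx_quadratic_loss M (delta (X w)) *m c) ord0 ord0])%E.

Definition sup_risk (delta : 'M[R]_(n, p) -> 'M[R]_(n, p)) (c : 'cV[R]_p) : \bar R :=
  ereal_sup [set quadratic_risk M delta c | M in [set: 'M[R]_(n, p)]].

Definition estimators : set ('M[R]_(n, p) -> 'M[R]_(n, p)) :=
  [set delta | measurable_fun setT delta].

Definition minimax (delta : 'M[R]_(n, p) -> 'M[R]_(n, p)) : Prop :=
  estimators delta /\
  forall c : 'cV[R]_p,
    sup_risk delta c = ereal_inf [set sup_risk delta' c | delta' in estimators].

End minimaxity.

Section existence.
Context {R : realType}.

Lemma normal_product_exists (k : nat) (m : 'I_k -> R) :
  exists mu : probability (k.-tuple (measurableTypeR R)) R,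
    forall B : 'I_k -> set R, (forall i, measurable (B i)) ->
      mu [set t | forall i, B i (tnth t i)] =
      (\prod_(i < k) normal_prob (m i) 1 (B i))%E.
Proof.
elim: k m => [|k IH] m.
  exists (dirac [tuple]) => B mB; rewrite big_ord0 /= diracE mem_set//.
  by case.
have [mu muE] := IH (fun i => m (lift ord0 i)).
pose f (x : measurableTypeR R * k.-tuple (measurableTypeR R)) :=
  [the k.+1.-tuple (measurableTypeR R) of x.1 :: x.2].
have mf : measurable_fun setT f by exact: measurable_cons.
pose nu : probability _ R := normal_prob (m ord0) 1.
pose F : {mfun (measurableTypeR R * k.-tuple (measurableTypeR R))%type >->
    k.+1.-tuple (measurableTypeR R)} := mfun_Sub (mem_set mf).
exists (distribution [the probability _ R of (nu \x mu)%E] F) => B mB.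
rewrite big_ord_recl -muE => [|i]; last exact: mB.
rewrite /distribution /pushforward /=.
rewrite -[normal_prob _ _ _]/(nu _) -(@product_measure1E _ _ _ _ _ nu mu)//; last first.
  rewrite (_ : [set _ | _] = \bigcap_(i in [set: 'I_k])
      ((@tnth _ _ ^~ i) @^-1` B (lift ord0 i))); last first.
    by apply/seteqP; split=> [t tB i _|t tB i] /=; [exact: tB|exact: (tB i)].
  apply: fin_bigcap_measurable => // i _.
  rewrite -[_ @^-1` _]setTI.
  apply: (@measurable_tnth _ (measurableTypeR R) _ i) => //.
  exact: mB.
  exact: mB.
congr (product_measure1 _ mu _); apply/seteqP; split=> [[x t]|[x t]] /=.
  move=> xtB; split=> [|i]; first exact: (xtB ord0).
  by have := xtB (lift ord0 i); rewrite tnthS.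
move=> [xB tB] i; have [->|i0] := eqVneq i ord0; first exact: xB.
have [j ->] : exists j, i = lift ord0 j.
  by case: (unliftP ord0 i) i0 => [j -> _|-> /eqP//]; exists j.
by rewrite tnthS; exact: tB.
Qed.

HB.instance Definition _ n p := isMeasurableFun.Build _ _ _ _
  (@idfun 'M[R]_(n, p)) (@measurable_id _ _ setT).

(* matrix_normal is satisfiable for every mean M. *)
Lemma matrix_normal_exists n p (M : 'M[R]_(n, p)) :
  exists P : probability 'M[R]_(n, p) R, matrix_normal (idfun : {RV P >-> _}) M.
Proof.
pose m (k : 'I_#|{: 'I_n * 'I_p}|) := mx_entry (enum_val k) M.
have [mu muE] := normal_product_exists m.
pose f (t : #|{: 'I_n * 'I_p}|.-tuple (measurableTypeR R)) : 'M[R]_(n, p) :=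
  \matrix_(i, j) tnth t (enum_rank (i, j)).
have mf : measurable_fun setT f.
  apply: measurable_fun_mxP => -[i j].
  rewrite (_ : _ \o f = @tnth _ (measurableTypeR R) ^~ (enum_rank (i, j))).
    exact: measurable_tnth.
  by apply/funext => t; rewrite /= /mx_entry mxE.
pose P := distribution mu (mfun_Sub (mem_set mf)).
have PE (J : {set 'I_n * 'I_p}) (B : 'I_n * 'I_p -> set R) :
    (forall ij, measurable (B ij)) ->
    P (\bigcap_(ij in [set` J]) (mx_entry ij @^-1` B ij)) =
    (\prod_(ij in J) normal_prob (mx_entry ij M) 1 (B ij))%E.
  move=> mB; pose B' ij := if ij \in J then B ij else setT.
  have mB' ij : measurable (B' ij) by rewrite /B'; case: ifP.
  have := muE (fun k => B' (enum_val k)) (fun k => mB' _).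
  rewrite (_ : (\prod_(i < _) _)%E =
      (\prod_ij normal_prob (mx_entry ij M) 1 (B' ij))%E); last first.
    rewrite (reindex (@enum_val _ {: 'I_n * 'I_p}))//=.
    by apply: onW_bij; exact: enum_val_bij.
  rewrite [RHS](bigID [in J])/= [X in (_ * X)%E](_ : _ = 1%E); last first.
    apply: big1 => ij /negbTE ijJ.
    rewrite /B' ijJ.
    exact: (probability_setT (normal_prob (mx_entry ij M) 1 : probability _ R)).
  rewrite mule1 => muB; rewrite (eq_bigr (fun ij => normal_prob (mx_entry ij M) 1 (B' ij))).
    rewrite -muB /P /distribution /pushforward /=; congr (mu _).
    apply/seteqP; split=> t /= tB.
      move=> k; rewrite /B'; case: ifPn => // kJ.
      have /= := tB _ kJ; rewrite /mx_entry mxE.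
      by case: (enum_val k) (enum_valK k) => i j <-.
    move=> [i j] ijJ /=; rewrite /mx_entry mxE /=.
    by have := tB (enum_rank (i, j)); rewrite enum_rankK /B' ijJ.
  by move=> ij ijJ; rewrite /B' ijJ.
have P1 ij (B : set R) : measurable B ->
    P (mx_entry ij @^-1` B) = normal_prob (mx_entry ij M) 1 B.
  move=> mB; have := PE [set ij]%SET (fun=> B) (fun=> mB).
  rewrite big_set1 => <-; congr (P _).
  apply/seteqP; split=> A /=.
    by move=> AB ij'; rewrite /= inE => /eqP ->.
  by move=> /(_ ij); apply; rewrite /= inE.
exists P; split=> [J B mB|i j B mB]; last exact: P1.
rewrite [LHS]PE//; apply: eq_bigr => ij _.
by rewrite [RHS]P1.
Qed.

End existence.

(* Main.v *)
(* Write k = n - p - 1 and S = X^T X. Both sides of the minimax identity equal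
   n |c|^2.

   Upper bound. For e > 0 the regularized estimator X (I - k (S + e I)^-1) is
   smooth with bounded shrinkage, so that Stein's identity applies. With
   q = c^T (S + e I)^-1 c, the divergence of X (S + e I)^-1 c in the directions
   e_a c^T is at least k q, and |X (S + e I)^-1 c|^2 <= q; hence the risk is at
   most n |c|^2 - k^2 E q. This bounds E q uniformly in e, which forces S to be
   almost surely invertible, and Fatou's lemma as e -> 0 bounds the risk of the
   Efron-Morris estimator. Stein's identity is obtained by comparing the two
   ways of shifting the mean: translating X, or multiplying by a likelihood
   ratio.

   Lower bound. Let b_a be the bias of the a-th coordinate of an estimator of
   M c. Moving the mean by s e_a c^T / |c|^2 and expanding with the likelihood
   ratio gives a finite-difference information inequality: if the risk were
   everywhere below n |c|^2, then for some s > 0 the increments of the b_a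
   would have a sum bounded above by a negative constant. Averaging over the
   points of a large box contradicts the boundedness of the biases. *)
From HB Require Import structures.
From mathcomp Require Import all_boot all_order all_algebra.
From mathcomp Require Import all_classical all_reals all_analysis.
From mathcomp Require Import measurable_realfun.
From mathcomp Require Import ring lra.
Require Import Defs.

Set Implicit Arguments.
Unset Strict Implicit.
Unset Printing Implicit Defensive.

Import Order.TTheory GRing.Theory Num.Theory.
Import numFieldNormedType.Exports.

Local Open Scope classical_set_scope.
Local Open Scope ring_scope.

(** * Laws of normal matrices *)

Section density.
Context d (T : measurableType d) (R : realType) (mu : {measure set T -> \bar R}).
Local Open Scope ereal_scope.

(** The proofs of measurability and nonnegativity are arguments, so that the measure structure
    declared below can be found from the term alone. *)
Definition mdensity (w : T -> R) of measurable_fun setT w &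
  (forall x, 0 <= w x)%R := fun A : set T => \int[mu]_(x in A) (w x)%:E.

Section mdensity_measure.
Variables (w : T -> R) (mw : measurable_fun setT w) (w0 : (forall x, 0 <= w x)%R).

Let mdensity0 : mdensity mw w0 set0 = 0.
Proof. exact: integral_set0. Qed.

Let mdensity_ge0 A : 0 <= mdensity mw w0 A.
Proof. by apply: integral_ge0 => x _; rewrite lee_fin. Qed.

Let mdensity_sigma_additive : semi_sigma_additive (mdensity mw w0).
Proof.
move=> F mF tF mUF; rewrite /mdensity ge0_integral_bigcup//; last 2 first.
- by apply/measurable_EFinP; exact: measurable_funTS.
- by move=> x _; rewrite lee_fin.
apply: is_cvg_ereal_nneg_natsum_cond => k _ _.
by apply: integral_ge0 => x _; rewrite lee_fin.
Qed.

HB.instance Definition _ := isMeasure.Build _ _ _ (mdensity mw w0)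
  mdensity0 mdensity_ge0 mdensity_sigma_additive.

End mdensity_measure.

Import HBNNSimple.

(** The hypothesis on sets extends to simple functions by linearity, then to nonnegative functions
    by monotone convergence along [nnsfun_approx]. Leaving [nu] arbitrary lets pushforwards and
    restrictions qualify. *)
Lemma ge0_integral_density (nu : {measure set T -> \bar R}) (w : T -> R)
    (f : T -> \bar R) :
    measurable_fun setT w -> (forall x, 0 <= w x)%R ->
    (forall A, measurable A -> nu A = \int[mu]_(x in A) (w x)%:E) ->
    measurable_fun setT f -> (forall x, 0 <= f x) ->
  \int[nu]_x f x = \int[mu]_x (f x * (w x)%:E).
Proof.
move=> mw w0 nuE mf f0.
pose f_ := nnsfun_approx measurableT mf.
transitivity (limn (fun n => \int[nu]_x (f_ n x)%:E)).
  rewrite -monotone_convergence//.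
  - by apply: eq_integral => x _; apply/esym/cvg_lim => //; exact: cvg_nnsfun_approx.
  - by move=> k; exact/measurable_EFinP/measurable_funTS.
  - by move=> *; rewrite lee_fin.
  - by move=> x _ a b ab; rewrite lee_fin; exact/lefP/nd_nnsfun_approx.
transitivity (limn (fun n => \int[mu]_x ((f_ n x)%:E * (w x)%:E))); last first.
  rewrite -monotone_convergence//.
  - apply: eq_integral => x _; apply/cvg_lim => //.
    apply: cvgeZr => //; exact: cvg_nnsfun_approx.
  - move=> k; apply: emeasurable_funM; exact/measurable_EFinP/measurable_funTS.
  - by move=> *; rewrite lee_fin mulr_ge0.
  - move=> x _ a b ab; rewrite lee_fin ler_wpM2r//.
    exact/lefP/nd_nnsfun_approx.
apply/congr_lim/funext => k.
under eq_integral do rewrite fimfunE// -fsumEFin//.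
rewrite ge0_integral_fsum//; last 2 first.
- by move=> r; exact/measurable_EFinP/measurableT_comp.
- by move=> r x _; rewrite nnfun_muleindic_ge0.
under [RHS]eq_integral.
  move=> x _; rewrite fimfunE// -fsumEFin// ge0_mule_fsuml; last first.
    by move=> r; rewrite nnfun_muleindic_ge0.
  over.
rewrite ge0_integral_fsum//; last 2 first.
- move=> r; apply: emeasurable_funM; apply/measurable_EFinP => //.
  exact/measurableT_comp.
- by move=> r x _; rewrite mule_ge0 ?nnfun_muleindic_ge0 ?lee_fin.
apply: eq_fsbigr => r _; have [r0|r0] := leP 0%R r; last first.
  have -> : f_ k @^-1` [set r] = set0.
    apply/seteqP; split => x //= fr; have : (0 <= f_ k x)%R by [].
    by rewrite fr leNgt r0.
  by rewrite !integral0_eq// => x _; rewrite indicE in_set0 mulr0 ?mul0e.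
under [LHS]eq_integral do rewrite EFinM.
rewrite ge0_integralZl//; last first.
  by apply/measurable_EFinP/measurable_indic.
rewrite integral_indic// setIT nuE//.
under [RHS]eq_integral do rewrite EFinM -muleA.
rewrite ge0_integralZl//; last 2 first.
- by apply: emeasurable_funM; apply/measurable_EFinP.
- by move=> x _; rewrite mule_ge0 ?lee_fin.
congr (_ * _); rewrite integral_mkcond; apply: eq_integral => x _.
by rewrite patchE indicE; case: ifPn => _; rewrite ?mul1e ?mul0e.
Qed.

End density.

(** * Measures on matrices and their values on rectangles *)

Section matrix_measure.
Context {R : realType} {n p : nat}.
Local Open Scope ereal_scope.
Implicit Types B : 'I_n * 'I_p -> set R.

Definition rect B : set 'M[R]_(n, p) := [set A | forall ij, B ij (mx_entry ij A)].

Lemma measurable_rect B : (forall ij, measurable (B ij)) -> measurable (rect B).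
Proof.
move=> mB; rewrite (_ : rect B = \bigcap_(ij in [set: 'I_n * 'I_p])
    (mx_entry ij @^-1` B ij)); last first.
  by apply/seteqP; split=> [A AB ij _|A AB ij]; [exact: AB|exact: (AB ij)].
apply: fin_bigcap_measurable => // ij _.
by rewrite -[_ @^-1` _]setTI; exact: measurable_mx_entry.
Qed.

(** Rectangles are stable under intersection, and they generate the sigma-algebra because a cylinder
    is a rectangle whose other sides are full; finite mass then gives uniqueness. *)
Lemma measure_rect_unique (m1 m2 : {measure set 'M[R]_(n, p) -> \bar R}) :
    (forall B, (forall ij, measurable (B ij)) -> m1 (rect B) = m2 (rect B)) ->
    m1 setT < +oo ->
  forall A, measurable A -> m1 A = m2 A.
Proof.
move=> m12 m1T; pose G := [set rect B | B in [set B | forall ij, measurable (B ij)]].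
apply: (measure_unique G (fun=> setT)) => //.
- apply/seteqP; split.
    apply: smallest_sub; first exact: smallest_sigma_algebra.
    move=> _ [ij [B [mB ->]]]; apply: sub_sigma_algebra.
    exists (fun kl => if kl == ij then B else setT); first by move=> kl; case: ifP.
    apply/seteqP; split=> A /=; first by move/(_ ij); rewrite eqxx.
    by move=> AB kl; case: eqP => // ->.
  apply: smallest_sub; first exact: sigma_algebra_measurable.
  by move=> _ [B mB <-]; exact: measurable_rect.
- move=> _ _ [B mB <-] [C mC <-]; exists (fun ij => B ij `&` C ij).
    by move=> ij; exact: measurableI.
  apply/seteqP; split=> [A AB|A [AB AC]] /=; first by split=> ij; case: (AB ij).
  by move=> ij; split; [exact: AB|exact: AC].
- by move=> _; exists (fun=> setT) => //; apply/seteqP; split.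
- by apply/seteqP; split=> // x _; exists 0%N.
- by move=> _ [B mB <-]; exact: m12.
Qed.

(** Independence and marginals merge into one product formula on rectangles, which determines the
    law by [measure_rect_unique]. *)
Definition normal_law (M : 'M[R]_(n, p)) (mu : set 'M[R]_(n, p) -> \bar R) :=
  forall B, (forall ij, measurable (B ij)) ->
    mu (rect B) = \prod_ij normal_prob (mx_entry ij M) 1 (B ij).

End matrix_measure.

Lemma matrix_normal_law (R : realType) (n p : nat) d (T : measurableType d)
    (P : probability T R) (X : {RV P >-> 'M[R]_(n, p)}) (M : 'M[R]_(n, p)) :
  matrix_normal X M -> normal_law M (distribution P X).
Proof.
move=> [indX lawX] B mB.
rewrite (_ : \prod_ij _ = \prod_(ij in [set: 'I_n * 'I_p]%SET)
    P ((mx_entry ij \o X : {RV P >-> R}) @^-1` B ij))%E; last first.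
  apply: eq_big => [ij|[i j] _]; first by rewrite finset.in_setT.
  by rewrite -lawX.
rewrite -indX// /distribution /pushforward; congr (P _).
apply/seteqP; split=> [w wB ij _|w wB ij]; first exact: wB.
by have := wB ij; apply => /=; rewrite finset.in_setT.
Qed.

(** * Translation and change of mean on the real line *)

Section lebesgue_shift.
Context {R : realType} (s : R).

Definition shiftR (x : measurableTypeR R) : measurableTypeR R := x + s.

Lemma measurable_shiftR : measurable_fun setT shiftR.
Proof. exact: measurable_funD. Qed.


Lemma lebesgue_measure_shift (A : set R) : measurable A ->
  pushforward (@lebesgue_measure R) shiftR A = lebesgue_measure A.
Proof.
move=> mA; apply/esym/lebesgue_measure_unique => //=.
  exact: measurable_shiftR.
move=> _ _ [[a b]] _ <-.
rewrite /pushforward (_ : _ @^-1` _ = `]a - s, b - s]%classic); last first.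
  by apply/seteqP; split => x /=; rewrite !in_itv/= /shiftR ltrBlDr lerBrDr.
by rewrite !lebesgue_measure_itv/= !lte_fin ltrD2r -!EFinB; case: ifP => // _; congr (_%:E); ring.
Qed.

End lebesgue_shift.

Section normal_prob_mean.
Context {R : realType}.
Implicit Types m s : R.

Let pdfE m (x : R) : normal_pdf m 1 x = normal_peak 1 * expR (- (x - m) ^+ 2 / 2).
Proof. by rewrite normal_pdfE ?oner_neq0// /normal_fun expr1n. Qed.

Lemma normal_prob_shift m s (A : set R) : measurable A ->
  normal_prob (m + s) 1 A = normal_prob m 1 ((fun x => x + s) @^-1` A).
Proof.
have pdf_shift (x : R) : normal_pdf (m + s) 1 (x + s) = normal_pdf m 1 x.
  by rewrite !pdfE (_ : x + s - (m + s) = x - m)//; ring.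
move=> mA; rewrite /normal_prob.
transitivity (\int[pushforward lebesgue_measure (shiftR s)]_(x in A)
   (normal_pdf (m + s) 1 x)%:E)%E.
  apply: eq_measure_integral => [|ms B mB _]; first exact: measurable_shiftR.
  exact/esym/lebesgue_measure_shift.
rewrite (ge0_integral_pushforward (measurable_shiftR s))//.
- by congr (integral _ _ _); apply/funext => x; rewrite -pdf_shift.
- by apply/measurable_EFinP/measurable_funTS; exact: measurable_normal_pdf.
- by move=> x _; rewrite lee_fin normal_pdf_ge0.
Qed.

Lemma normal_prob_density m s (A : set R) : measurable A ->
  normal_prob (m + s) 1 A =
  (\int[normal_prob m 1]_(x in A) (expR (s * (x - m) - s ^+ 2 / 2))%:E)%E.
Proof.
move=> mA.
have mh : measurable_fun setT (fun x : R => expR (s * (x - m) - s ^+ 2 / 2)).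
  apply: measurableT_comp => //; apply: measurable_funB => //.
  by apply: measurable_funM => //; exact: measurable_funB.
rewrite [RHS]integral_mkcond (@ge0_integral_density _ _ _ lebesgue_measure
    (normal_prob m 1) (normal_pdf m 1)).
- rewrite /normal_prob [LHS]integral_mkcond.
  congr (integral _ _ _); apply/funext => x.
  rewrite !patchE; case: ifPn => _; last by rewrite mul0e.
  rewrite -EFinM !pdfE mulrCA -expRD.
  by rewrite (_ : - (x - (m + s)) ^+ 2 / 2 =
      s * (x - m) - s ^+ 2 / 2 + - (x - m) ^+ 2 / 2)//; field.
- exact: measurable_normal_pdf.
- by move=> x; exact: normal_pdf_ge0.
- by [].
- apply/(measurable_restrictT _ _).1 => //.
  by apply/measurable_EFinP/measurable_funTS.
- by move=> x; rewrite patchE; case: ifP => // _; rewrite lee_fin expR_ge0.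
Qed.

End normal_prob_mean.

(** The Frobenius inner product. *)
Definition mxdot {R : realType} {n p : nat} (A B : 'M[R]_(n, p)) : R :=
  \sum_ij mx_entry ij A * mx_entry ij B.

Section mxdot_theory.
Context {R : realType} {n p : nat}.
Implicit Types A B C : 'M[R]_(n, p).

Lemma mxdotC A B : mxdot A B = mxdot B A.
Proof. by apply: eq_bigr => ij _; rewrite mulrC. Qed.

Lemma mxdotDl A B C : mxdot (A + B) C = mxdot A C + mxdot B C.
Proof. by rewrite -big_split; apply: eq_bigr => ij _; rewrite /mx_entry mxE mulrDl. Qed.

Lemma mxdotDr A B C : mxdot A (B + C) = mxdot A B + mxdot A C.
Proof. by rewrite mxdotC mxdotDl !(mxdotC A). Qed.

Lemma mxdotZl s A B : mxdot (s *: A) B = s * mxdot A B.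
Proof. by rewrite mulr_sumr; apply: eq_bigr => ij _; rewrite /mx_entry mxE mulrA. Qed.

Lemma mxdotZr s A B : mxdot A (s *: B) = s * mxdot A B.
Proof. by rewrite mxdotC mxdotZl mxdotC. Qed.

Lemma mxdotNr A B : mxdot A (- B) = - mxdot A B.
Proof. by rewrite -scaleN1r mxdotZr mulN1r. Qed.

Lemma mxdotNl A B : mxdot (- A) B = - mxdot A B.
Proof. by rewrite mxdotC mxdotNr mxdotC. Qed.

Lemma mxdot0l A : mxdot 0 A = 0.
Proof. by rewrite -(scale0r A) mxdotZl mul0r. Qed.

Lemma mxdot_delta i j A : mxdot (delta_mx i j) A = A i j.
Proof.
rewrite /mxdot (bigD1 (i, j))//= big1 ?addr0 => [|[k l] kl].
  by rewrite /mx_entry mxE !eqxx mul1r.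
rewrite /mx_entry mxE; case: eqVneq => [ki|]; last by rewrite mul0r.
case: eqVneq => [lj|]; last by rewrite mul0r.
by move: kl; rewrite /= in ki lj *; rewrite ki lj eqxx.
Qed.

Lemma mxdot_ge0 A : 0 <= mxdot A A.
Proof. by apply: sumr_ge0 => ij _; rewrite -expr2 sqr_ge0. Qed.

Lemma measurable_mxdot A : measurable_fun setT (mxdot A).
Proof.
by apply: measurable_sum => ij; apply: measurable_funM.
Qed.

Lemma measurable_mx_shift (D : 'M[R]_(n, p)) : measurable_fun setT (fun A : 'M[R]_(n, p) => A + D).
Proof.
apply: measurable_fun_mxP => ij.
apply: (eq_measurable_fun (fun A => mx_entry ij A + mx_entry ij D)).
  by move=> A _; rewrite /mx_entry /= mxE.
by apply: measurable_funD.
Qed.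

End mxdot_theory.

(* The likelihood ratio of the normal law with mean M + D against the one
   with mean M (see [normal_family_density]). *)
Definition shift_density {R : realType} {n p : nat} (M D A : 'M[R]_(n, p)) : R :=
  expR (mxdot D (A - M) - mxdot D D / 2).

Section shift_density_theory.
Context {R : realType} {n p : nat}.
Implicit Types M D : 'M[R]_(n, p).

Lemma measurable_shift_density M D : measurable_fun setT (shift_density M D).
Proof.
apply: measurableT_comp => //; apply: measurable_funB => //.
exact: (measurableT_comp (measurable_mxdot D) (measurable_mx_shift (- M))).
Qed.

Lemma shift_density_gt0 M D A : 0 < shift_density M D A.
Proof. exact: expR_gt0. Qed.

(** A cocycle rule: likelihood ratios multiply along successive changes of mean, which reduces the
    density formula to one entry at a time. *)
Lemma shift_densityD M D E A :
  shift_density M (D + E) A = shift_density (M + D) E A * shift_density M D A.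
Proof.
rewrite -expRD; congr expR.
by rewrite !(mxdotDl, mxdotDr, mxdotNr) (mxdotC E D); field.
Qed.

End shift_density_theory.

(** * Translation and likelihood ratio for the normal family *)

Section normal_family.
Context {R : realType} {n p : nat} (mu : 'M[R]_(n, p) -> probability 'M[R]_(n, p) R).
Hypothesis mu_law : forall M, normal_law M (mu M).
Local Open Scope ereal_scope.
Implicit Types M D : 'M[R]_(n, p).

Lemma normal_family_shift M D (F : 'M[R]_(n, p) -> \bar R) :
    measurable_fun setT F -> (forall A, 0 <= F A) ->
  \int[mu (M + D)%R]_A F A = \int[mu M]_A F (A + D)%R.
Proof.
move=> mF F0; have mD := @measurable_mx_shift R n p D.
transitivity (\int[pushforward (mu M) (fun A => A + D)%R]_A F A); last first.
  by rewrite (ge0_integral_pushforward mD).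
apply: (eq_measure_integral (pushforward (mu M) (fun A => A + D)%R)) => A mA _.
apply: measure_rect_unique => // [B mB|]; last first.
  exact: (le_lt_trans (probability_le1 _ measurableT) (ltry _)).
transitivity (\prod_ij normal_prob (mx_entry ij (M + D)%R) 1 (B ij)).
  exact: mu_law.
rewrite -[RHS]/(mu M ((fun A => A + D)%R @^-1` rect B)).
rewrite (_ : _ @^-1` _ = rect (fun ij => (fun x => x + mx_entry ij D)%R @^-1` B ij)); last first.
  by apply/seteqP; split=> C CB ij; have := CB ij; rewrite /= /mx_entry mxE.
transitivity (\prod_ij normal_prob (mx_entry ij M) 1
    ((fun x => x + mx_entry ij D)%R @^-1` B ij)); last first.
  apply/esym/mu_law => ij; rewrite -[_ @^-1` _]setTI.
  have : measurable_fun setT (fun x : R => x + mx_entry ij D)%R.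
    exact: measurable_funD.
  by apply.
by apply: eq_bigr => ij _; rewrite -normal_prob_shift// /mx_entry mxE.
Qed.

(** The base mean [M] is quantified inside, so that the property can be applied again after a first
    translation; this makes it stable under sums. *)
Definition has_shift_density D := forall M (F : 'M[R]_(n, p) -> \bar R),
  measurable_fun setT F -> (forall A, 0 <= F A) ->
  \int[mu (M + D)%R]_A F A = \int[mu M]_A (F A * (shift_density M D A)%:E).

Lemma has_shift_density0 : has_shift_density 0%R.
Proof.
move=> M F mF F0; rewrite addr0; apply: eq_integral => A _.
by rewrite /shift_density !mxdot0l mul0r subrr expR0 mule1.
Qed.

Lemma has_shift_densityD D E :
  has_shift_density D -> has_shift_density E -> has_shift_density (D + E)%R.
Proof.
move=> hD hE M F mF F0; rewrite addrA hE// hD.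
- by apply: eq_integral => A _; rewrite shift_densityD EFinM muleA.
- apply: emeasurable_funM => //; apply/measurable_EFinP.
  exact: measurable_shift_density.
- by move=> A; rewrite mule_ge0// lee_fin expR_ge0.
Qed.

(** Only the entry [(i, j)] changes mean. On a rectangle the other sides contribute a constant
    factor, and the claim becomes [normal_prob_density] for that entry. *)
Lemma has_shift_density_delta (s : R) i j :
  has_shift_density (s *: delta_mx i j)%R.
Proof.
move=> M; set D : 'M[R]_(n, p) := (s *: _)%R; pose ij : 'I_n * 'I_p := (i, j).
pose m := mx_entry ij M; pose h (x : R) := expR (s * (x - m) - s ^+ 2 / 2).
have mh : measurable_fun setT h.
  apply: measurableT_comp => //; apply: measurable_funB => //.
  by apply: measurable_funM => //; exact: measurable_funB.
have dE A : shift_density M D A = h (mx_entry ij A).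
  rewrite /shift_density !mxdotZl mxdotZr !mxdot_delta !mxE !eqxx mulr1.
  by rewrite -expr2.
have md := @measurable_shift_density _ _ _ M D.
have d0 A : (0 <= shift_density M D A)%R := expR_ge0 _.
suff densE A : measurable A -> mu (M + D)%R A = mdensity (mu M) md d0 A.
  by move=> F mF F0; exact: ge0_integral_density.
move: A; apply: measure_rect_unique => // [B mB|]; last first.
  exact: (le_lt_trans (probability_le1 _ measurableT) (ltry _)).
(* [B' C] is [B] with its side at [ij] replaced by [C]. Restricting [mu M] to [rect (B' setT)] and
   pushing forward along the entry gives [c] times a one-dimensional normal law. *)
pose B' C kl := if kl == ij then C else B kl.
have mB' C : measurable C -> forall kl, measurable (B' C kl).
  by move=> mC kl; rewrite /B'; case: ifP.
have mrest := measurable_rect (mB' _ (@measurableT _ _)).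
pose nu := mrestr (mu M) mrest.
pose c := \prod_(kl | kl != ij) normal_prob (mx_entry kl M) 1 (B kl).
have cfin : c \is a fin_num.
  by apply: prode_fin_num => kl _; apply: fin_num_measure; exact: mB.
have c0 : 0 <= c by apply: prode_ge0 => kl _;
  exact: (measure_ge0 (normal_prob _ 1 : probability _ R)).
have prodE C : measurable C ->
    \prod_kl normal_prob (mx_entry kl M) 1 (B' C kl) = normal_prob m 1 C * c.
  move=> mC; rewrite (bigD1 ij)//= /B' eqxx; congr (_ * _).
  by apply: eq_bigr => kl /negPf ->.
pose e : 'M[R]_(n, p) -> measurableTypeR R := mx_entry ij.
have mE : measurable_fun setT e by exact: measurable_mx_entry.
have nuE C : measurable C -> pushforward nu e C =
    \int[normal_prob m 1]_(x in C) (cst (fine c) x)%:E.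
  move=> mC; transitivity ((fine c)%:E * normal_prob m 1 C); last first.
    exact/esym/(integral_cst (normal_prob m 1) mC (fine c)%:E).
  rewrite fineK// muleC -prodE// -mu_law; last exact: mB'.
  rewrite /pushforward /nu /mrestr; congr (mu M _).
  apply/seteqP; split=> A /=.
    move=> [AC AB] kl; rewrite /B'; have := AB kl; rewrite /B'.
    by case: eqP => // ->.
  move=> AB; split; first by have := AB ij; rewrite /B' eqxx.
  by move=> kl; have := AB kl; rewrite /B'; case: eqP.
transitivity (\prod_ij normal_prob (mx_entry ij (M + D)%R) 1 (B ij)).
  exact: mu_law.
transitivity (normal_prob (m + s) 1 (B ij) * c).
  have DE kl : mx_entry kl (M + D)%R = if kl == ij then (m + s)%R else mx_entry kl M.
    rewrite /m /mx_entry !mxE -pair_eqE /pair_eq /=.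
    case: eqP => [->|_] /=; last by rewrite mulr0 addr0.
    by case: eqP => [->|_] /=; rewrite ?mulr1// mulr0 addr0.
  rewrite (bigD1 ij) /= ?DE ?eqxx; last by [].
  rewrite /c; congr (_ * _); apply: eq_bigr => kl klij.
  by rewrite DE (negPf klij).
rewrite normal_prob_density//.
transitivity (\int[pushforward nu e]_(x in B ij) (h x)%:E).
  pose g : measurableTypeR R -> \bar R := (fun x => (h x)%:E) \_ (B ij).
  have mg : measurable_fun setT g.
    apply/(measurable_restrictT _ _).1; first exact: mB.
    by apply/measurable_EFinP/measurable_funTS.
  have g0 x : 0 <= g x.
    by rewrite /g patchE; case: ifP => // _; rewrite lee_fin expR_ge0.
  rewrite [RHS]integral_mkcond -/g.
  have -> : \int[pushforward nu e]_x g x =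
      \int[normal_prob m 1]_x (g x * (cst (fine c) x)%:E).
    apply: (@ge0_integral_density _ (measurableTypeR R) R (normal_prob m 1)
      (pushforward nu e) (cst (fine c))) => //.
    by move=> x; rewrite fine_ge0.
  rewrite integral_mkcond -/g muleC -(fineK cfin) -ge0_integralZl//.
    by apply: eq_integral => x _; rewrite muleC.
  by rewrite fineK.
rewrite (ge0_integral_pushforward mE)//; last 2 first.
  by apply/measurable_EFinP/measurable_funTS.
  by move=> x _; rewrite lee_fin expR_ge0.
(* The restriction [nu] has the indicator of [rect (B' setT)] as density against [mu M], which leads
   back to an integral over [rect B]. *)
rewrite integral_mkcond (ge0_integral_density (w := \1_(rect (B' setT))) (mu := mu M))//.
- rewrite /mdensity [RHS]integral_mkcond; apply: eq_integral => A _.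
  rewrite !patchE indicE.
  have -> : (A \in rect B) = (A \in e @^-1` B ij) && (A \in rect (B' setT)).
    apply/idP/andP => [/set_mem AB|[/set_mem /= AB /set_mem AB']].
      split; apply/mem_set; first exact: AB.
      by move=> kl; rewrite /B'; case: eqP => // _; exact: AB.
    apply/mem_set => kl; have := AB' kl; rewrite /B'.
    by case: eqP => [->|].
  case: (A \in e @^-1` B ij) => /=; last by rewrite mul0e.
  by case: (A \in _); rewrite ?mule1 ?mule0// dE.
- by move=> A mA; rewrite integral_indic// setIC.
- apply/(measurable_restrictT _ _).1.
    by rewrite -[_ @^-1` _]setTI; apply: mE => //; exact: mB.
  apply: measurable_funTS; apply/measurable_EFinP.
  exact: (measurableT_comp mh mE).
- by move=> A; rewrite patchE; case: ifP => // _; rewrite lee_fin expR_ge0.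
- exact: mB.
Qed.

Lemma normal_family_density D : has_shift_density D.
Proof.
rewrite (matrix_sum_delta D).
elim/big_ind : _ => [||i _]; first exact: has_shift_density0.
  exact: has_shift_densityD.
elim/big_ind : _ => [||j _]; first exact: has_shift_density0.
  exact: has_shift_densityD.
exact: has_shift_density_delta.
Qed.

End normal_family.

(** * Moments and Stein's identity *)

Section real_integrals.
Context d (T : measurableType d) (R : realType) (P : probability T R).
Implicit Types f g : T -> R.

Definition rintegrable f := P.-integrable setT (EFin \o f).

Local Notation E f := (Rintegral P setT f).

Lemma rintegrable_cst (r : R) : rintegrable (cst r).
Proof. exact: finite_measure_integrable_cst. Qed.

Lemma rintegrableD f g : rintegrable f -> rintegrable g ->
  rintegrable (fun x => f x + g x).
Proof. by move=> fi gi; apply: eq_integrable (integrableD _ fi gi). Qed.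

Lemma rintegrableZ k f : rintegrable f -> rintegrable (fun x => k * f x).
Proof. by move=> fi; apply: eq_integrable (integrableZl _ k fi). Qed.

Lemma rintegrableB f g : rintegrable f -> rintegrable g ->
  rintegrable (fun x => f x - g x).
Proof. by move=> fi gi; apply: eq_integrable (integrableB _ fi gi). Qed.

Lemma rintegrable_sum I (s : seq I) (f : I -> T -> R) :
  (forall i, rintegrable (f i)) -> rintegrable (fun x => \sum_(i <- s) f i x).
Proof.
move=> fi; elim: s => [|i s IH].
  by apply: eq_integrable (rintegrable_cst 0) => // x _ /=; rewrite big_nil.
apply: eq_integrable (rintegrableD (fi i) IH) => // x _ /=.
by rewrite big_cons.
Qed.

Lemma measurable_rintegrable f : rintegrable f -> measurable_fun setT f.
Proof. by move=> /measurable_int/measurable_EFinP. Qed.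

Lemma rintegrable_le f g : measurable_fun setT f -> (forall x, `|f x| <= g x) ->
  rintegrable g -> rintegrable f.
Proof.
move=> mf fg; apply: le_integrable => //; first exact/measurable_EFinP.
by move=> x _; rewrite lee_fin (le_trans (fg x))// ler_norm.
Qed.

Lemma rintegrable_bounded f (r : R) : measurable_fun setT f ->
  (forall x, `|f x| <= r) -> rintegrable f.
Proof. by move=> mf fr; apply: rintegrable_le (rintegrable_cst r). Qed.

Lemma rintegrable_bounded_mul f g (r : R) : measurable_fun setT f ->
  (forall x, `|f x| <= r) -> rintegrable g -> rintegrable (fun x => f x * g x).
Proof.
move=> mf fr gi; apply: (@rintegrable_le _ (fun x => r * `|g x|)).
- by apply: measurable_funM => //; exact: measurable_rintegrable.
- by move=> x; rewrite normrM ler_wpM2r.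
- by apply: rintegrableZ; exact: integrable_norm.
Qed.

Lemma integral_EFin_Rintegral f : rintegrable f ->
  (\int[P]_x (f x)%:E)%E = (E f)%:E.
Proof. by move=> fi; rewrite /Rintegral fineK//; exact: integrable_fin_num. Qed.

Lemma Rintegral_cst1 (r : R) : E (fun=> r) = r.
Proof.
rewrite Rintegral_cst// [X in fine X](_ : _ = 1%E) ?mulr1//.
exact: probability_setT.
Qed.

Lemma rintegralD f g : rintegrable f -> rintegrable g ->
  E (fun x => f x + g x) = E f + E g.
Proof. exact: RintegralD. Qed.

Lemma rintegralB f g : rintegrable f -> rintegrable g ->
  E (fun x => f x - g x) = E f - E g.
Proof. exact: RintegralB. Qed.

Lemma rintegralZ k f : rintegrable f -> E (fun x => k * f x) = k * E f.
Proof. exact: RintegralZl. Qed.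

Lemma le_rintegral f g : rintegrable f -> rintegrable g ->
  (forall x, f x <= g x) -> E f <= E g.
Proof. by move=> fi gi fg; exact: le_Rintegral. Qed.

Lemma ler_norm_rintegral f g : rintegrable f -> rintegrable g ->
  (forall x, `|f x| <= g x) -> `|E f| <= E g.
Proof.
move=> fi gi fg; apply: le_trans (le_normr_Rintegral measurableT fi) _.
by apply: le_rintegral => //; exact: integrable_norm.
Qed.

Lemma Rintegral_sum I (s : seq I) (f : I -> T -> R) :
  (forall i, rintegrable (f i)) ->
  E (fun x => \sum_(i <- s) f i x) = \sum_(i <- s) E (f i).
Proof.
move=> fi; elim: s => [|i s IH].
  by under eq_Rintegral do rewrite big_nil; rewrite big_nil Rintegral_cst1.
under eq_Rintegral do rewrite big_cons.
by rewrite big_cons rintegralD ?IH//; exact: rintegrable_sum.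
Qed.

End real_integrals.

Lemma ler_norm_onesqr (R : realFieldType) (x : R) : `|x| <= 1 + x ^+ 2.
Proof. by rewrite ler_norml; apply/andP; split; nra. Qed.

(** * Elementary bounds on the exponential *)

Section expR_bounds.
Context {R : realType}.
Implicit Types x z : R.

(** The difference of the two sides vanishes at 0 and has derivative
    [(expR y - 1) ^+ 2 / expR y]. *)
Lemma sinh_ge x : 0 <= x -> 2 * x <= expR x - expR (- x).
Proof.
move=> x0; rewrite -subr_ge0.
pose f (y : R) := expR y - expR (- y) - 2 * y.
have f0 : f 0 = 0 by rewrite /f oppr0 mulr0 !subrr.
have df (y : R) : is_derive y 1 f (expR y + expR (- y) - 2).
  apply: is_derive_eq; rewrite /GRing.scale/=; ring.
rewrite -/(f x) -f0; apply: (@ger0_derive1_ndecry _ f 0) => //.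
- move=> y _; rewrite derive1E derive_val expRN.
  have e0 := expR_gt0 y; rewrite (_ : _ - 2 = (expR y - 1) ^+ 2 / expR y).
    by rewrite divr_ge0 ?sqr_ge0// ltW.
  by field; rewrite gt_eqF.
- apply: continuous_subspaceT => y; apply: differentiable_continuous.
  exact/derivable1_diffP/ex_derive.
Qed.

(** The right-hand side is the square of [expR (x / 2) - expR (- (x / 2))], so [sinh_ge] at [x / 2]
    applies. *)
Lemma sqr_le_expR x : x ^+ 2 <= expR x + expR (- x) - 2.
Proof.
wlog x0 : x / 0 <= x => [wl|].
  have [/wl//|/ltW x0] := leP 0 x.
  by have := wl (- x); rewrite sqrrN opprK (addrC (expR (- x))) oppr_ge0; exact.
have x20 : 0 <= x / 2 by rewrite divr_ge0.
have := sinh_ge x20; rewrite -(ler_pXn2r (n := 2))// ?nnegrE; last 2 first.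
- by rewrite mulr_ge0.
- by apply: le_trans (sinh_ge x20); rewrite mulr_ge0.
move=> h; suff -> : expR x + expR (- x) - 2 = (expR (x / 2) - expR (- (x / 2))) ^+ 2.
  by apply: le_trans h; rewrite mulrCA divff// mulr1.
have -> : expR x = expR (x / 2) ^+ 2 by rewrite -expRM_natl; congr expR; field.
have -> : expR (- x) = expR (- (x / 2)) ^+ 2.
  by rewrite -expRM_natl; congr expR; field.
by rewrite expRN; field; rewrite gt_eqF ?expR_gt0.
Qed.

(** The inequality [1 + y <= expR y] at [y = z] and [y = - z] places the error between 0 and
    [z * (expR z - 1)]. *)
Lemma expR_taylor1 z : `|expR z - 1 - z| <= z ^+ 2 * expR `|z|.
Proof.
have h1 := expR_ge1Dx z; have h2 := expR_ge1Dx (- z).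
have e0 := expR_gt0 z.
have e1z := expRxMexpNx_1 z.
have h3 : (1 - z) * expR z <= 1.
  by rewrite -[leRHS]e1z (mulrC (expR z)) ler_wpM2r// ltW.
have zz : expR z - 1 - z <= z * (expR z - 1) by lra.
rewrite ger0_norm; last by lra.
apply: (le_trans zz); have [z0|z0] := leP 0 z.
  by rewrite ger0_norm// expr2 -mulrA ler_wpM2l//; lra.
have e1 : 1 <= expR `|z| by apply: le_trans (expR_ge1Dx _); rewrite lerDl.
have : z ^+ 2 * 1 <= z ^+ 2 * expR `|z| by rewrite ler_wpM2l ?sqr_ge0.
by apply: le_trans; nra.
Qed.

End expR_bounds.

(** Writing [f] as [(f + |f|) - |f|] reduces to nonnegative functions. The pair [phi], [w] covers
    both changes of mean: [w = 1] for translation, [phi] the identity for the likelihood ratio. *)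
Lemma rintegral_transfer d (T : measurableType d) (R : realType)
    (P Q : probability T R) (phi : T -> T) (w : T -> R) :
    measurable_fun setT phi -> measurable_fun setT w -> (forall x, 0 <= w x) ->
    (forall F : T -> \bar R, measurable_fun setT F -> (forall x, 0 <= F x)%E ->
      \int[P]_x F x = \int[Q]_x (F (phi x) * (w x)%:E))%E ->
  forall f, rintegrable P f ->
  rintegrable Q (fun x => f (phi x) * w x) /\
  \int[P]_x f x = \int[Q]_x (f (phi x) * w x).
Proof.
move=> mphi mw w0 PQ.
have ge0 f : (forall x, 0 <= f x) -> rintegrable P f ->
    rintegrable Q (fun x => f (phi x) * w x) /\
    \int[P]_x f x = \int[Q]_x (f (phi x) * w x).
  move=> f0 fi; have mf := measurable_rintegrable fi.
  have PQf : (\int[P]_x (f x)%:E = \int[Q]_x (f (phi x) * w x)%:E)%E.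
    by rewrite PQ//; exact/measurable_EFinP.
  split; last by rewrite /Rintegral PQf.
  apply/integrableP; split.
    apply/measurable_EFinP/measurable_funM => //.
    exact: (measurableT_comp mf mphi).
  under eq_integral do rewrite gee0_abs ?lee_fin ?mulr_ge0//.
  by rewrite -PQf integral_EFin_Rintegral ?ltry.
move=> f fi.
have ai : rintegrable P (fun x => `|f x|) by exact: integrable_norm.
have fai := rintegrableD fi ai.
have [|iQa EQa] := ge0 _ _ ai; first by [].
have [|iQfa EQfa] := ge0 _ _ fai.
  by move=> x; rewrite -lerBlDr sub0r lerNl -normrN ler_norm.
have fE x : f (phi x) * w x = (f (phi x) + `|f (phi x)|) * w x - `|f (phi x)| * w x.
  by ring.
under eq_fun do rewrite fE; split; first exact: rintegrableB.
rewrite rintegralB// -EQfa -EQa -rintegralB//.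
by apply: eq_Rintegral => x _; ring.
Qed.

Section normal_moments.
Context {R : realType} {n p : nat} (mu : 'M[R]_(n, p) -> probability 'M[R]_(n, p) R).
Hypothesis mu_law : forall M, normal_law M (mu M).
Implicit Types M D : 'M[R]_(n, p).

Lemma rintegral_shift_density M D f : rintegrable (mu (M + D)) f ->
  rintegrable (mu M) (fun A => f A * shift_density M D A) /\
  \int[mu (M + D)]_A f A = \int[mu M]_A (f A * shift_density M D A).
Proof.
apply: (@rintegral_transfer _ _ _ _ _ idfun) => //.
- exact: measurable_shift_density.
- by move=> A; rewrite ltW// shift_density_gt0.
- by move=> F mF F0; exact: normal_family_density.
Qed.

Lemma rintegral_shift M D f : rintegrable (mu (M + D)) f ->
  rintegrable (mu M) (fun A => f (A + D)) /\
  \int[mu (M + D)]_A f A = \int[mu M]_A f (A + D).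
Proof.
move=> fi.
have [||F mF F0|] := @rintegral_transfer _ _ _ (mu (M + D)) (mu M)
  (fun A => A + D) (cst 1) (measurable_mx_shift D) _ _ _ f fi.
- by [].
- by move=> A; exact: ler01.
- rewrite normal_family_shift//.
  by under [RHS]eq_integral do rewrite mule1.
- have -> : (fun A => f (A + D) * cst 1 A) = (fun A => f (A + D)).
    by apply/funext => A; rewrite mulr1.
  by [].
Qed.

(** The likelihood ratio has total mass 1; removing its constant factor gives the moment generating
    function. *)
Lemma rintegral_expR_mxdot M D :
  rintegrable (mu M) (fun A => expR (mxdot D (A - M))) /\
  \int[mu M]_A expR (mxdot D (A - M)) = expR (mxdot D D / 2).
Proof.
have [di] := rintegral_shift_density (rintegrable_cst (mu (M + D)) 1).
rewrite Rintegral_cst1 => dE.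
have eE A : expR (mxdot D (A - M)) = expR (mxdot D D / 2) * (1 * shift_density M D A).
  by rewrite mul1r -expRD; congr expR; ring.
under eq_fun do rewrite eE; split; first exact: rintegrableZ.
by rewrite rintegralZ// -dE mulr1.
Qed.

Lemma measurable_mxdot_centered M D :
  measurable_fun setT (fun A : 'M[R]_(n, p) => mxdot D (A - M)).
Proof. exact: (measurableT_comp (measurable_mxdot D) (measurable_mx_shift (- M))). Qed.

Lemma rintegrable_sqr_mxdot M D :
  rintegrable (mu M) (fun A => mxdot D (A - M) ^+ 2).
Proof.
have [i1 _] := rintegral_expR_mxdot M D.
have [i2 _] := rintegral_expR_mxdot M (- D).
apply: (rintegrable_le _ _ (rintegrableB (rintegrableD i1 i2) (rintegrable_cst _ 2))).
  by apply: measurable_funX; exact: measurable_mxdot_centered.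
move=> A; rewrite ger0_norm ?sqr_ge0//.
by rewrite mxdotNl; exact: sqr_le_expR.
Qed.

(* From [t^2 Y^2 <= exp (t Y) + exp (- t Y) - 2] as [t] tends to [0]. *)
Lemma rintegral_sqr_mxdot_le M D :
  \int[mu M]_A (mxdot D (A - M) ^+ 2) <= mxdot D D.
Proof.
set v := mxdot D D; set I := \int[mu M]_A _.
have v0 : 0 <= v := mxdot_ge0 D.
have i2 := rintegrable_sqr_mxdot M D.
have key t : 0 < t -> t ^+ 2 * I <= 2 * (expR (t ^+ 2 * v / 2) - 1).
  move=> t0; have [ip Ep] := rintegral_expR_mxdot M (t *: D).
  have [im Em] := rintegral_expR_mxdot M (- t *: D).
  rewrite -rintegralZ//.
  apply: (@le_trans _ _ (\int[mu M]_A
      (expR (mxdot (t *: D) (A - M)) + expR (mxdot (- t *: D) (A - M)) - 2))).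
    apply: le_rintegral; first exact: rintegrableZ.
      by apply: rintegrableB; [exact: rintegrableD|exact: rintegrable_cst].
    move=> A; rewrite -exprMn !mxdotZl mulNr; exact: sqr_le_expR.
  rewrite rintegralB; last 2 first.
  - exact: rintegrableD.
  - exact: rintegrable_cst.
  rewrite rintegralD// Ep Em Rintegral_cst1 !mxdotZl !mxdotZr -/v.
  rewrite (_ : - t * (- t * v) = t ^+ 2 * v); last by ring.
  by rewrite (_ : t * (t * v) = t ^+ 2 * v); [lra|ring].
(* Choose [t] so small that [x = t ^+ 2 * v / 2] is at most [e]; then [(expR x - 1) * (1 - x) <= x],
   and the factor [t ^+ 2] cancels. *)
have {}key e : 0 < e -> e < 1 -> I * (1 - e) <= v.
  move=> e0 e1; have v1 : 0 < v + 1 by lra.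
  pose t := Num.sqrt (2 * e / (v + 1)).
  have t2 : t ^+ 2 = 2 * e / (v + 1) by rewrite sqr_sqrtr// divr_ge0 ?mulr_ge0 ?ltW.
  have t0 : 0 < t by rewrite sqrtr_gt0 divr_gt0// mulr_gt0.
  have := key _ t0; set x := t ^+ 2 * v / 2 => h.
  have t20 : 0 < t ^+ 2 by rewrite exprn_gt0.
  have x0 : 0 <= x by rewrite /x divr_ge0// mulr_ge0// ltW.
  have xe : x <= e.
    rewrite /x t2 (_ : _ / 2 = e * (v / (v + 1))); last by field; rewrite gt_eqF.
    by rewrite ler_piMr ?(ltW e0)// ler_pdivrMr// mul1r; lra.
  have ex : expR x * (1 - x) <= 1.
    rewrite -[leRHS](expRxMexpNx_1 x) ler_wpM2l ?expR_ge0//.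
    exact: expR_ge1Dx.
  have ex2 : (expR x - 1) * (1 - x) <= x by lra.
  have hx : t ^+ 2 * I * (1 - x) <= 2 * x.
    apply: (@le_trans _ _ (2 * (expR x - 1) * (1 - x))); last lra.
    by rewrite ler_wpM2r//; lra.
  have : t ^+ 2 * (I * (1 - x)) <= t ^+ 2 * v by rewrite mulrA (le_trans hx)// /x; lra.
  rewrite ler_pM2l//; apply: le_trans; rewrite ler_wpM2l//; last by lra.
  by apply: Rintegral_ge0 => A _; exact: sqr_ge0.
rewrite leNgt; apply/negP => vI.
have I0 : 0 < I by exact: le_lt_trans vI.
have e0 : 0 < (I - v) / (2 * I) by rewrite divr_gt0 ?mulr_gt0 ?subr_gt0.
have e1 : (I - v) / (2 * I) < 1 by rewrite ltr_pdivrMr ?mulr_gt0//; lra.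
have := key _ e0 e1.
rewrite (_ : I * _ = (I + v) / 2); last by field; rewrite gt_eqF.
lra.
Qed.

(* Differentiate the identity [E f(A + tD) = E f(A) exp(t Y - t^2 |D|^2 / 2)],
   with [Y = <D, A - M>], at [t = 0]: both sides are expanded with an [O(t^2)]
   error. *)
Lemma stein_identity M D (f g : 'M[R]_(n, p) -> R) (B C : R) :
    measurable_fun setT f -> measurable_fun setT g ->
    (forall A, `|f A| <= B) -> (forall A, `|g A| <= B) ->
    (forall A t, 0 < t -> t <= 1 -> `|f (A + t *: D) - f A - t * g A| <= C * t ^+ 2) ->
  \int[mu M]_A (f A * mxdot D (A - M)) = \int[mu M]_A g A.
Proof.
move=> mf mg fB gB fgC.
pose Y A := mxdot D (A - M); pose v := mxdot D D.
have v0 : 0 <= v := mxdot_ge0 D.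
(* [W] is integrable and bounds the second-order error of the likelihood ratio divided by [t ^+ 2],
   for all [t] in []0, 1]]. With [a = |Y| + v], it comes from [a ^+ 2 <= 2 * expR a] and [expR (2 *
   |Y|) <= expR (2 * Y) + expR (- 2 * Y)]; [v / 2] absorbs the quadratic part of the exponent. *)
pose W A := 2 * expR (2 * v) *
  (expR (mxdot (2 *: D) (A - M)) + expR (mxdot (- 2 *: D) (A - M))) + v / 2.
have W0 A : 0 <= W A.
  by rewrite addr_ge0 ?divr_ge0 ?mulr_ge0 ?addr_ge0 ?expR_ge0.
have B0 : 0 <= B by apply: le_trans (fB 0); exact: normr_ge0.
have C0 : 0 <= C.
  by have := fgC 0 1 ltr01 (lexx _); rewrite expr1n mulr1; apply: le_trans; exact: normr_ge0.
have mY : measurable_fun setT Y := measurable_mxdot_centered M D.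
have Wi : rintegrable (mu M) W.
  apply: rintegrableD; last exact: rintegrable_cst.
  apply: rintegrableZ; apply: rintegrableD.
    by have [] := rintegral_expR_mxdot M (2 *: D).
  by have [] := rintegral_expR_mxdot M (- 2 *: D).
have fi N : rintegrable (mu N) f by exact: rintegrable_bounded fB.
have gi : rintegrable (mu M) g by exact: rintegrable_bounded gB.
have Yi : rintegrable (mu M) Y.
  apply: rintegrable_le (rintegrableD (rintegrable_cst _ 1) (rintegrable_sqr_mxdot M D)) => //.
  by move=> A /=; exact: ler_norm_onesqr.
have fYi : rintegrable (mu M) (fun A => f A * Y A) by exact: rintegrable_bounded_mul fB Yi.
have hW A t : 0 < t -> t <= 1 -> `|shift_density M (t *: D) A - 1 - t * Y A| <= t ^+ 2 * W A.
  move=> t0 t1; rewrite /shift_density !mxdotZl mxdotZr -/(Y A) -/v.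
  set z := t * Y A - _.
  have zE : z = t * (Y A - t * v / 2) by rewrite /z; field.
  have zb : `|z| <= t * (`|Y A| + v).
    rewrite zE normrM gtr0_norm// ler_wpM2l ?(ltW t0)//.
    apply: (le_trans (ler_normB _ _)); rewrite lerD2l ger0_norm.
      by nra.
    by rewrite divr_ge0// mulr_ge0// ltW.
  have zb1 : `|z| <= `|Y A| + v.
    by apply: (le_trans zb); rewrite ler_piMl// addr_ge0.
  have -> : expR z - 1 - t * Y A = (expR z - 1 - z) - t ^+ 2 * (v / 2).
    by rewrite /z; field.
  apply: (le_trans (ler_normB _ _)).
  rewrite /W mulrDr lerD//; last by rewrite ger0_norm// mulr_ge0 ?sqr_ge0 ?divr_ge0.
  apply: (le_trans (expR_taylor1 z)).
  pose a := `|Y A| + v; have a0 : 0 <= a by rewrite addr_ge0.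
  have z2 : z ^+ 2 <= t ^+ 2 * (2 * expR a).
    apply: (@le_trans _ _ (t ^+ 2 * a ^+ 2)).
      rewrite -exprMn -(ger0_norm (sqr_ge0 z)) normrX.
      by rewrite ler_pXn2r// nnegrE// mulr_ge0// ltW.
    rewrite ler_wpM2l ?sqr_ge0//; have := @expR_ge1Dxn _ a 1 a0.
    rewrite (_ : 2`!%:R = 2)//; lra.
  apply: (@le_trans _ _ (t ^+ 2 * (2 * expR a) * expR a)).
    by rewrite ler_pM ?sqr_ge0 ?expR_ge0// ler_expR.
  rewrite -mulrA ler_wpM2l ?sqr_ge0// -!mulrA ler_wpM2l// -expRD.
  rewrite (_ : a + a = 2 * v + 2 * `|Y A|); last by rewrite /a; ring.
  rewrite expRD ler_wpM2l ?expR_ge0// !mxdotZl -/(Y A).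
  by case: (ger0P (Y A)) => _; rewrite ?mulrN -?mulNr ?lerDl ?lerDr expR_ge0.
pose I := \int[mu M]_A (f A * Y A) - \int[mu M]_A g A.
pose K := C + B * \int[mu M]_A W A.
have K0 : 0 <= K by rewrite addr_ge0// mulr_ge0// Rintegral_ge0.
(* [I] does not depend on [t], so a bound of order [t] forces [I = 0]. *)
suff key t : 0 < t -> t <= 1 -> `|I| <= K * t.
  apply/eqP; rewrite -subr_eq0 -normr_eq0 eq_le normr_ge0 andbT.
  rewrite -/I leNgt; apply/negP => I0.
  have t0 : 0 < `|I| / (2 * K + `|I|) by rewrite divr_gt0// ltr_wpDl// mulr_ge0.
  have t1 : `|I| / (2 * K + `|I|) <= 1.
    by rewrite ler_pdivrMr ?mul1r ?lerDr ?mulr_ge0// ltr_wpDl// mulr_ge0.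
  have := key _ t0 t1; rewrite mulrA ler_pdivlMr; last by rewrite ltr_wpDl// mulr_ge0.
  by nra.
move=> t0 t1.
have [fsi Efs] := rintegral_shift (fi (M + t *: D)).
have [fdi Efd] := rintegral_shift_density (fi (M + t *: D)).
(* Translation and likelihood ratio give the same mean of [f] under [M + t *: D]; subtracting the
   two expansions leaves only second-order errors besides [t * I]. *)
have EI : t * I = \int[mu M]_A (f (A + t *: D) - f A - t * g A) -
    \int[mu M]_A (f A * (shift_density M (t *: D) A - 1 - t * Y A)).
  have -> : \int[mu M]_A (f A * (shift_density M (t *: D) A - 1 - t * Y A)) =
      \int[mu M]_A (f A * shift_density M (t *: D) A - f A - t * (f A * Y A)).
    by apply: eq_Rintegral => A _; ring.
  rewrite !(rintegralB, rintegralZ)//; do ?[exact: rintegrableB|exact: rintegrableZ].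
  by rewrite -Efs -Efd /I; ring.
rewrite -(ler_pM2l t0) -[X in X * _ <= _](gtr0_norm t0) -normrM EI.
apply: (le_trans (ler_normB _ _)).
rewrite (_ : t * (K * t) = C * t ^+ 2 + t ^+ 2 * B * \int[mu M]_A W A); last by rewrite /K; ring.
apply: lerD.
  rewrite -(Rintegral_cst1 (mu M) (C * t ^+ 2)).
  apply: ler_norm_rintegral; last by move=> A; exact: fgC.
    by apply: rintegrableB; [exact: rintegrableB|exact: rintegrableZ].
  exact: rintegrable_cst.
rewrite -rintegralZ//; apply: ler_norm_rintegral.
- apply: (rintegrable_bounded_mul mf fB); apply: rintegrableB; last exact: rintegrableZ.
  apply: rintegrableB; last exact: rintegrable_cst.
  have [] := rintegral_shift_density (rintegrable_cst (mu (M + t *: D)) 1).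
  by under eq_fun do rewrite mul1r.
- exact: rintegrableZ.
- move=> A; rewrite normrM mulrAC mulrC ler_pM//; exact: hW.
Qed.

End normal_moments.

(** * The regularized inverse Gram matrix *)

Section sqnorm.
Context {R : realDomainType}.

Definition sqnorm {m : nat} (x : 'cV[R]_m) : R := (x^T *m x) 0 0.

Lemma sqnormE m (x : 'cV[R]_m) : sqnorm x = \sum_i x i 0 ^+ 2.
Proof. by rewrite /sqnorm mxE; apply: eq_bigr => i _; rewrite mxE expr2. Qed.

Lemma sqnorm_ge0 m (x : 'cV[R]_m) : 0 <= sqnorm x.
Proof. by rewrite sqnormE sumr_ge0// => i _; exact: sqr_ge0. Qed.

Lemma sqr_le_sqnorm m (x : 'cV[R]_m) i : x i 0 ^+ 2 <= sqnorm x.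
Proof. by rewrite sqnormE (bigD1 i)//= lerDl sumr_ge0// => j _; exact: sqr_ge0. Qed.

Lemma sqnorm_eq0 m (x : 'cV[R]_m) : sqnorm x = 0 -> x = 0.
Proof.
move=> x0; apply/matrixP => i j; rewrite ord1 mxE; apply/eqP.
by rewrite -sqrf_eq0 eq_le sqr_ge0 andbT -x0 sqr_le_sqnorm.
Qed.

End sqnorm.

Section regularized_gram.
Context {R : realFieldType} {n p : nat} (e : R).
Hypothesis e0 : 0 < e.
Implicit Types X : 'M[R]_(n, p).

Definition rgram X : 'M[R]_p := X^T *m X + e%:M.
Definition rinv X : 'M[R]_p := invmx (rgram X).

Lemma rgram_form X (x : 'cV[R]_p) :
  (x^T *m rgram X *m x) 0 0 = sqnorm (X *m x) + e * sqnorm x.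
Proof.
rewrite /rgram mulmxDr mulmxDl mxE; congr (_ + _).
  by rewrite /sqnorm trmx_mul !mulmxA.
by rewrite mul_mx_scalar -scalemxAl mxE.
Qed.

Lemma rgram_unit X : rgram X \in unitmx.
Proof.
rewrite unitmxE unitfE; apply/det0P => -[v v0 vA].
have := rgram_form X v^T; rewrite trmxK vA mul0mx mxE => /esym/eqP.
rewrite paddr_eq0 ?sqnorm_ge0 ?mulr_ge0 ?sqnorm_ge0 ?(ltW e0)// => /andP[_].
rewrite mulf_eq0 (gt_eqF e0) => /eqP/sqnorm_eq0 /(congr1 trmx).
by rewrite trmxK trmx0 => /eqP; apply/negP.
Qed.

Lemma tr_rgram X : (rgram X)^T = rgram X.
Proof. by rewrite /rgram linearD /= trmx_mul trmxK tr_scalar_mx. Qed.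

Lemma tr_rinv X : (rinv X)^T = rinv X.
Proof. by rewrite /rinv trmx_inv tr_rgram. Qed.

Lemma rinv_form X (u : 'cV[R]_p) :
  (u^T *m rinv X *m u) 0 0 =
  sqnorm (X *m rinv X *m u) + e * sqnorm (rinv X *m u).
Proof.
rewrite -mulmxA -[in RHS]mulmxA -rgram_form trmx_mul tr_rinv.
by rewrite -!mulmxA mulKmx // rgram_unit.
Qed.

Lemma rinv_form_ge0 X (u : 'cV[R]_p) : 0 <= (u^T *m rinv X *m u) 0 0.
Proof. by rewrite rinv_form addr_ge0 ?mulr_ge0 ?sqnorm_ge0 ?(ltW e0). Qed.

Let quad_le (x y : R) : 0 < y -> y * x ^+ 2 <= x -> x <= y^-1.
Proof.
move=> y0 yx; have [x0|x0] := leP x 0.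
  by rewrite (le_trans x0)// invr_ge0 ltW.
by rewrite -(ler_pM2l y0) mulfV ?gt_eqF// -(ler_pM2r x0) mul1r -mulrA -expr2.
Qed.

Let rinv_delta X j (x := rinv X *m delta_mx j 0 : 'cV[R]_p) :
  sqnorm (X *m x) + e * sqnorm x = x j 0.
Proof.
rewrite -rgram_form trmx_mul tr_rinv trmx_delta -!mulmxA mulKmx ?rgram_unit//.
by rewrite -rowE mxE.
Qed.

Let rinv_delta_le X j : (rinv X *m delta_mx j 0 : 'cV[R]_p) j 0 <= e^-1.
Proof.
apply: quad_le => //; rewrite -[leRHS]rinv_delta.
apply: (@le_trans _ _ (e * sqnorm (rinv X *m delta_mx j 0 : 'cV[R]_p))).
  by rewrite ler_wpM2l ?(ltW e0)// sqr_le_sqnorm.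
by rewrite lerDr sqnorm_ge0.
Qed.

Let sqr_norm_le (x y : R) : 0 <= y -> x ^+ 2 <= y ^+ 2 -> `|x| <= y.
Proof.
by move=> y0; rewrite -[_ <= y]ler_sqr ?nnegrE// real_normK ?num_real.
Qed.

(** For the column [x] of index [j], [e * sqnorm x <= x j 0 <= e^-1], and each squared entry is at
    most [sqnorm x]. *)
Lemma rinv_bound X i j : `|rinv X i j| <= e^-1.
Proof.
apply: sqr_norm_le; first by rewrite invr_ge0 ltW.
have := rinv_delta_le X j; have := rinv_delta X j.
set x := _ *m _ => xj xje; rewrite -(ler_pM2l e0).
apply: (@le_trans _ _ (e * sqnorm x)).
  rewrite ler_wpM2l ?(ltW e0)//; apply: le_trans (sqr_le_sqnorm x i).
  by rewrite /x -colE mxE.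
rewrite expr2 mulrA divff ?gt_eqF// mul1r (le_trans _ xje)// -xj.
by rewrite lerDr sqnorm_ge0.
Qed.

Lemma mul_rinv_bound X a j : (X *m rinv X) a j ^+ 2 <= e^-1.
Proof.
have := rinv_delta_le X j; have := rinv_delta X j.
set x := _ *m _ => xj xje; apply: (le_trans _ xje); rewrite -xj.
apply: (@le_trans _ _ (sqnorm (X *m x))); last first.
  by rewrite lerDl mulr_ge0 ?sqnorm_ge0 ?(ltW e0).
have -> : (X *m rinv X) a j = (X *m x) a 0 by rewrite /x mulmxA -colE [RHS]mxE.
exact: sqr_le_sqnorm.
Qed.

(** The column [z] of index [b] satisfies [sqnorm z <= z b 0]. Hence [z b 0 <= 1], and then
    [sqnorm z <= 1]. *)
Lemma hat_bound X a b : `|(X *m rinv X *m X^T) a b| <= 1.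
Proof.
pose z := X *m (rinv X *m (X^T *m (delta_mx b 0 : 'cV[R]_n))).
have zE a' : (X *m rinv X *m X^T) a' b = z a' 0.
  by rewrite /z !mulmxA -colE [RHS]mxE.
have zb : sqnorm z <= z b 0.
  have := rinv_form X (X^T *m (delta_mx b 0 : 'cV[R]_n)).
  rewrite trmx_mul trmxK trmx_delta -!mulmxA -/z -rowE mxE => ->.
  by rewrite lerDl mulr_ge0 ?sqnorm_ge0 ?(ltW e0).
have zb1 : z b 0 <= 1.
  rewrite -[leRHS]invr1; apply: quad_le => //; rewrite mul1r.
  exact: le_trans (sqr_le_sqnorm z b) zb.
rewrite zE; apply: sqr_norm_le => //; rewrite expr1n.
by apply: le_trans zb1; apply: le_trans zb; exact: sqr_le_sqnorm.
Qed.

Lemma mxtrace_rinv_ge0 X : 0 <= \tr (rinv X).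
Proof.
apply: sumr_ge0 => i _; have := rinv_form_ge0 X (delta_mx i 0).
by rewrite trmx_delta -mulmxA -rowE -colE !mxE.
Qed.

Lemma gramE X : X^T *m X = rgram X - e%:M.
Proof. by rewrite addrK. Qed.

(** By cyclicity the trace equals [p - e * \tr (rinv X)]. *)
Lemma mxtrace_hat_le X : \tr (X *m rinv X *m X^T) <= p%:R.
Proof.
rewrite mxtrace_mulC mulmxA gramE mulmxBl mulmxV ?rgram_unit//.
rewrite linearB /= mxtrace1 mul_scalar_mx linearZ /=.
by rewrite lerBlDr lerDl mulr_ge0 ?mxtrace_rinv_ge0 ?ltW.
Qed.

Lemma sqnorm_mul_rinv_le X (c : 'cV[R]_p) :
  sqnorm (X *m rinv X *m c) <= (c^T *m rinv X *m c) 0 0.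
Proof. by rewrite rinv_form lerDl mulr_ge0 ?sqnorm_ge0 ?ltW. Qed.

(* The a-th summand is the derivative of (X *m rinv X *m c) a 0 in the
   direction of the matrix whose a-th row is c^T and whose other rows vanish. *)
Definition rdiv (c : 'cV[R]_p) (a : 'I_n) X : R :=
  (c^T *m rinv X *m c) 0 0 * (1 - (X *m rinv X *m X^T) a a)
  - (X *m rinv X *m c) a 0 ^+ 2.

(** With [H] the hat matrix and [q] the quadratic form, the sum is [q * (n - \tr H) - sqnorm (X *m
    rinv X *m c)]; here [\tr H <= p] and the last term is at most [q]. *)
Lemma sum_rdiv_ge (c : 'cV[R]_p) X :
  (n%:R - p%:R - 1) * (c^T *m rinv X *m c) 0 0 <= \sum_a rdiv c a X.
Proof.
rewrite sumrB -sqnormE -mulr_sumr sumrB sumr_const card_ord -/(mxtrace _).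
have := sqnorm_mul_rinv_le X c; have := mxtrace_hat_le X.
have := rinv_form_ge0 X c.
by move=> ? ? ?; nra.
Qed.

End regularized_gram.

(** * Uniformly bounded families of matrices *)

Section bounded_matrix_family.
Context {R : realDomainType} {T : Type} (S : T -> Prop).

Definition mxbounded {q r : nat} (F : T -> 'M[R]_(q, r)) : Prop :=
  exists C, forall x, S x -> forall i j, `|F x i j| <= C.

Lemma mxbounded_cst q r (A : 'M[R]_(q, r)) : mxbounded (fun=> A).
Proof.
exists (\sum_i \sum_j `|A i j|) => x _ i j.
rewrite (bigD1 i)//= (bigD1 j)//= -addrA lerDl addr_ge0// ?sumr_ge0//.
by move=> k _; rewrite sumr_ge0.
Qed.

Lemma mxboundedD q r (F G : T -> 'M[R]_(q, r)) :
  mxbounded F -> mxbounded G -> mxbounded (fun x => F x + G x).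
Proof.
move=> [C FC] [C' GC]; exists (C + C') => x Sx i j; rewrite mxE.
by rewrite (le_trans (ler_normD _ _))// lerD ?FC ?GC.
Qed.

Lemma mxboundedN q r (F : T -> 'M[R]_(q, r)) :
  mxbounded F -> mxbounded (fun x => - F x).
Proof. by move=> [C FC]; exists C => x Sx i j; rewrite mxE normrN FC. Qed.

Lemma mxboundedB q r (F G : T -> 'M[R]_(q, r)) :
  mxbounded F -> mxbounded G -> mxbounded (fun x => F x - G x).
Proof. by move=> bF bG; apply: mxboundedD => //; exact: mxboundedN. Qed.

Lemma mxboundedM q r s (F : T -> 'M[R]_(q, r)) (G : T -> 'M[R]_(r, s)) :
  mxbounded F -> mxbounded G -> mxbounded (fun x => F x *m G x).
Proof.
move=> [C FC] [C' GC]; exists (\sum_(k < r) C * C') => x Sx i j; rewrite mxE.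
apply: (le_trans (ler_norm_sum _ _ _)); apply: ler_sum => k _.
by rewrite normrM ler_pM ?FC ?GC.
Qed.

Lemma mxbounded_tr q r (F : T -> 'M[R]_(q, r)) :
  mxbounded F -> mxbounded (fun x => (F x)^T).
Proof. by move=> [C FC]; exists C => x Sx i j; rewrite mxE FC. Qed.

Lemma mxboundedZ q r (h : T -> R) (F : T -> 'M[R]_(q, r)) :
  (forall x, S x -> `|h x| <= 1) -> mxbounded F -> mxbounded (fun x => h x *: F x).
Proof.
move=> h1 [C FC]; exists C => x Sx i j; rewrite mxE normrM.
by rewrite (le_trans _ (FC x Sx i j))// ler_piMl ?h1.
Qed.

End bounded_matrix_family.

(** * First-order expansion of the shrinkage map *)

Section rinv_taylor.
Context {R : realFieldType} {n p : nat} (e : R).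
Hypothesis e0 : 0 < e.
Implicit Types (X D : 'M[R]_(n, p)) (t : R).

Local Notation rinv := (rinv e).

Lemma rinv_bounded (T : Type) (S : T -> Prop) (X : T -> 'M[R]_(n, p)) :
  [/\ mxbounded S (fun x => rinv (X x)), mxbounded S (fun x => X x *m rinv (X x))
    & mxbounded S (fun x => X x *m rinv (X x) *m (X x)^T)].
Proof.
split.
- by exists e^-1 => x _ i j; exact: rinv_bound.
- exists (1 + e^-1) => x _ i j; have := mul_rinv_bound e0 (X x) i j.
  by move=> h; rewrite ler_norml; apply/andP; split; nra.
- by exists 1 => x _ i j; exact: hat_bound.
Qed.

Definition gram_slope D X : 'M[R]_p := D^T *m X + X^T *m D.

Let trmxDZ X D t : (X + t *: D)^T = X^T + t *: D^T.
Proof. by apply/matrixP => i j; rewrite !mxE. Qed.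

Lemma rgramD X D t :
  rgram e (X + t *: D) = rgram e X + t *: (gram_slope D X + t *: (D^T *m D)).
Proof.
rewrite /rgram /gram_slope trmxDZ mulmxDl !mulmxDr.
rewrite -!scalemxAl -!scalemxAr.
by apply/matrixP => i j; rewrite !mxE; ring.
Qed.

(** The resolvent identity, with the perturbed inverse on the right or on the left; [remainderE]
    uses both orders. *)
Lemma rinvD X D t (L := gram_slope D X + t *: (D^T *m D)) :
  rinv (X + t *: D) = rinv X - t *: (rinv X *m L *m rinv (X + t *: D)) /\
  rinv (X + t *: D) = rinv X - t *: (rinv (X + t *: D) *m L *m rinv X).
Proof.
set B := rinv X; set U := rinv (X + t *: D).
have uX := rgram_unit e0 X; have uXt := rgram_unit e0 (X + t *: D).
have LE : t *: L = rgram e (X + t *: D) - rgram e X by rewrite rgramD addrAC subrr add0r.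
split.
  rewrite scalemxAl scalemxAr LE mulmxBr mulmxBl mulVmx// mul1mx.
  by rewrite -mulmxA mulmxV// mulmx1 subKr.
rewrite scalemxAl scalemxAr LE mulmxBr mulmxBl mulVmx// mul1mx.
by rewrite -mulmxA mulmxV// mulmx1 opprB addrCA subrr addr0.
Qed.

(** The derivative of [X *m rinv X] in the direction [D]; [gram_slope D X] is that of the Gram
    matrix. *)
Definition mul_rinv_slope D X : 'M[R]_(n, p) :=
  D *m rinv X - X *m rinv X *m gram_slope D X *m rinv X.

(** An exact second-order remainder, so that an error bound uniform in [X] only asks to bound this
    expression. *)
Let remainder D X t : 'M[R]_(n, p) :=
  let U := rinv (X + t *: D) in
  let L := gram_slope D X + t *: (D^T *m D) in
  X *m rinv X *m L *m U *m gram_slope D X *m rinv X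
  - X *m U *m (D^T *m D) *m rinv X - D *m rinv X *m L *m U.

Let remainderE D X t :
  (X + t *: D) *m rinv (X + t *: D) - X *m rinv X - t *: mul_rinv_slope D X =
  t ^+ 2 *: remainder D X t.
Proof.
rewrite /remainder /mul_rinv_slope.
have [] := rinvD X D t.
set B := rinv X; set U := rinv (X + t *: D); set K := gram_slope D X.
set G := D^T *m D; set L := K + t *: G => e1 e2.
have eXU : X *m U = X *m B - t *: (X *m U *m K *m B) - t ^+ 2 *: (X *m U *m G *m B).
  rewrite [in LHS]e2 mulmxBr -addrA -opprD; congr (_ - _).
  rewrite -scalemxAr !mulmxA /L mulmxDr mulmxDl scalerDr; congr (_ + _).
  by rewrite -scalemxAr -scalemxAl scalerA expr2 /G !mulmxA.
have eXUKB : X *m U *m K *m B =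
    X *m B *m K *m B - t *: (X *m B *m L *m U *m K *m B).
  by rewrite [in LHS]e1 mulmxBr !mulmxBl -scalemxAr -!scalemxAl !mulmxA.
have eDU : D *m U = D *m B - t *: (D *m B *m L *m U).
  by rewrite [in LHS]e1 mulmxBr -scalemxAr !mulmxA.
rewrite mulmxDl -scalemxAl [in LHS]eXU [in LHS]eXUKB [in LHS]eDU.
move: (X *m B *m L *m U *m K *m B) (X *m B *m K *m B) (D *m B *m L *m U) (X *m U *m G *m B).
move=> a b c d; apply/matrixP => i j; rewrite !mxE; ring.
Qed.

(** [X] itself is unbounded. Each occurrence is therefore grouped with inverses into [rinv],
    [X rinv] or [X rinv X^T], which [rinv_bounded] controls. *)
Let remainder_bounded D :
  mxbounded (fun x : 'M[R]_(n, p) * R => 0 < x.2 /\ x.2 <= 1) (fun x => remainder D x.1 x.2).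
Proof.
set S := (X in mxbounded X _).
have [bB bp1 bh1] := rinv_bounded S fst.
have [bU bq bk] := rinv_bounded S (fun x => x.1 + x.2 *: D).
have t1 (x : 'M[R]_(n, p) * R) : S x -> `|x.2| <= 1 by move=> [/ltW x0 x1]; rewrite ger0_norm.
pose B (x : 'M[R]_(n, p) * R) := rinv x.1.
pose U (x : 'M[R]_(n, p) * R) := rinv (x.1 + x.2 *: D).
pose p1 (x : 'M[R]_(n, p) * R) := x.1 *m B x.
pose p2 (x : 'M[R]_(n, p) * R) := x.1 *m U x.
pose h1 (x : 'M[R]_(n, p) * R) := x.1 *m B x *m x.1^T.
pose h2 (x : 'M[R]_(n, p) * R) := x.1 *m U x *m x.1^T.
(* [p2] and [h2] pair [X] with the inverse at [X + t D]; writing [X] as [(X + t D) - t D] leads back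
   to controlled products. *)
have bp2 : mxbounded S p2.
  have -> : p2 = (fun x => (x.1 + x.2 *: D) *m U x - x.2 *: (D *m U x)).
    by apply/funext => x; rewrite mulmxDl -scalemxAl addrK.
  apply: mxboundedB => //; apply: mxboundedZ => //.
  by apply: mxboundedM => //; exact: mxbounded_cst.
have bh2 : mxbounded S h2.
  have -> : h2 = (fun x => (x.1 + x.2 *: D) *m U x *m (x.1 + x.2 *: D)^T
      - x.2 *: (D *m (p2 x)^T) - x.2 *: ((x.1 + x.2 *: D) *m U x *m D^T)).
    apply/funext => x; rewrite /h2 /p2 trmx_mul tr_rinv trmxDZ.
    rewrite mulmxDl mulmxDr mulmxDl -?scalemxAl -?scalemxAr -?scalemxAl !mulmxA.
    rewrite ?mulmxDl -?scalemxAl.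
    by apply/matrixP => i j; rewrite !mxE; ring.
  apply: mxboundedB; first apply: mxboundedB => //.
    apply: mxboundedZ => //; apply: mxboundedM; first exact: mxbounded_cst.
    exact: mxbounded_tr.
  apply: mxboundedZ => //; apply: mxboundedM => //; exact: mxbounded_cst.
have bD := @mxbounded_cst R _ S _ _ D.
have bDT := @mxbounded_cst R _ S _ _ D^T.
pose G := D^T *m D.
have bG := @mxbounded_cst R _ S _ _ G.
(* In the notation of [remainderE], [V] is [U K B], [W] is [B L U] and [Q] is [X B L U K B],
   expanded so that no [X] stands alone. *)
pose V x := U x *m D^T *m p1 x + (p2 x)^T *m D *m B x.
pose W x := B x *m D^T *m p2 x + (p1 x)^T *m D *m U x + x.2 *: (B x *m G *m U x).
pose Q x := p1 x *m D^T *m (p2 x *m D^T *m p1 x + h2 x *m D *m B x)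
  + h1 x *m D *m V x + x.2 *: (p1 x *m G *m V x).
have -> : (fun x => remainder D x.1 x.2) = (fun x => Q x - p2 x *m G *m B x - D *m W x).
  apply/funext => x; rewrite /remainder /Q /V /W /h1 /h2 /p1 /p2 /gram_slope -/(B x) -/(U x) -/G.
  rewrite !trmx_mul !tr_rinv -/(B x) -/(U x).
  rewrite !(mulmxDl, mulmxDr) -?scalemxAl -?scalemxAr -?scalemxAl !mulmxA.
  by apply/matrixP => i j; rewrite !mxE; ring.
have bV : mxbounded S V.
  by apply: mxboundedD; do ?[apply: mxboundedM => //]; exact: mxbounded_tr.
have bW : mxbounded S W.
  apply: mxboundedD; last by apply: mxboundedZ => //; do ?[apply: mxboundedM => //].
  by apply: mxboundedD; do ?[apply: mxboundedM => //]; exact: mxbounded_tr.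
apply: mxboundedB; last exact: mxboundedM.
apply: mxboundedB; last by do ?[apply: mxboundedM => //].
apply: mxboundedD; last by apply: mxboundedZ => //; do ?[apply: mxboundedM => //].
apply: mxboundedD; last by do ?[apply: mxboundedM => //].
apply: mxboundedM; first exact: mxboundedM.
by apply: mxboundedD; do ?[apply: mxboundedM => //].
Qed.

Lemma mul_rinv_taylor D : exists C, forall X t i j, 0 < t -> t <= 1 ->
  `|((X + t *: D) *m rinv (X + t *: D) - X *m rinv X - t *: mul_rinv_slope D X) i j|
    <= C * t ^+ 2.
Proof.
have [C bC] := remainder_bounded D; exists C => X t i j t0 t1.
rewrite remainderE mxE normrM (ger0_norm (sqr_ge0 t)) mulrC ler_wpM2r ?sqr_ge0//.
exact: (bC (X, t)).
Qed.

End rinv_taylor.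

(** * Risk of the Efron-Morris estimator *)

Section measurable_matrix_expressions.
Context d (T : measurableType d) (R : realType).

(** Inversion is written as [f] times a real power of [f ^+ 2], which is measurable; at 0 both sides
    are 0 because [0^-1 = 0]. *)
Lemma measurable_inverse (f : T -> R) :
  measurable_fun setT f -> measurable_fun setT (fun x => (f x)^-1).
Proof.
move=> mf; have -> : (fun x => (f x)^-1) = (fun x => f x * (f x ^+ 2) `^ (-1)).
  apply/funext => x; rewrite powR_inv1 ?sqr_ge0//.
  by have [->|fx0] := eqVneq (f x) 0; [rewrite invr0 mul0r|field].
apply: measurable_funM => //.
exact: (measurableT_comp (measurable_powR (-1)) (measurable_funX 2 mf)).
Qed.

Definition mxmeasurable {q r : nat} (F : T -> 'M[R]_(q, r)) : Prop :=
  forall i j, measurable_fun setT (fun x => F x i j).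

Lemma mxmeasurable_cst q r (A : 'M[R]_(q, r)) : mxmeasurable (fun=> A).
Proof. by []. Qed.

Lemma mxmeasurableD q r (F G : T -> 'M[R]_(q, r)) :
  mxmeasurable F -> mxmeasurable G -> mxmeasurable (fun x => F x + G x).
Proof.
by move=> mF mG i j; under eq_fun do rewrite mxE; exact: measurable_funD.
Qed.

Lemma mxmeasurableM q r s (F : T -> 'M[R]_(q, r)) (G : T -> 'M[R]_(r, s)) :
  mxmeasurable F -> mxmeasurable G -> mxmeasurable (fun x => F x *m G x).
Proof.
move=> mF mG i j; under eq_fun do rewrite mxE.
by apply: measurable_sum => k; exact: measurable_funM.
Qed.

Lemma mxmeasurableZ q r (h : T -> R) (F : T -> 'M[R]_(q, r)) :
  measurable_fun setT h -> mxmeasurable F -> mxmeasurable (fun x => h x *: F x).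
Proof.
by move=> mh mF i j; under eq_fun do rewrite mxE; exact: measurable_funM.
Qed.

Lemma mxmeasurable_tr q r (F : T -> 'M[R]_(q, r)) :
  mxmeasurable F -> mxmeasurable (fun x => (F x)^T).
Proof. by move=> mF i j; under eq_fun do rewrite mxE; exact: mF. Qed.

Lemma measurable_det q (F : T -> 'M[R]_q) :
  mxmeasurable F -> measurable_fun setT (fun x => \det (F x)).
Proof.
move=> mF; apply: measurable_sum => s; apply: measurable_funM => //.
by apply: measurable_prod => i _; exact: mF.
Qed.

Lemma mxmeasurable_inv q (F : T -> 'M[R]_q) :
  mxmeasurable F -> mxmeasurable (fun x => invmx (F x)).
Proof.
move=> mF; have mdet := measurable_det mF.
have madj : mxmeasurable (fun x => \adj (F x)).
  move=> i j; under eq_fun do rewrite mxE /cofactor.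
  apply: measurable_funM => //; apply: measurable_det => k l.
  by under eq_fun do rewrite !mxE; exact: mF.
(* Cramer's rule where the determinant is nonzero; elsewhere [invmx] returns its argument. *)
move=> i j; have -> : (fun x => invmx (F x) i j) = (fun x =>
    if \det (F x) == 0 then F x i j else (\det (F x))^-1 * (\adj (F x)) i j).
  apply/funext => x; rewrite /invmx unitmxE unitfE.
  by case: eqP => //= _; rewrite mxE.
apply: measurable_fun_ifT; first exact: measurable_fun_eqr.
  exact: mF.
by apply: measurable_funM; [exact: measurable_inverse|exact: madj].
Qed.

Lemma measurable_sqnorm q (F : T -> 'cV[R]_q) :
  mxmeasurable F -> measurable_fun setT (fun x => sqnorm (F x)).
Proof. by move=> mF; apply: mxmeasurableM => //; exact: mxmeasurable_tr. Qed.

End measurable_matrix_expressions.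

Lemma mxmeasurable_id (R : realType) n p : mxmeasurable (fun A : 'M[R]_(n, p) => A).
Proof. by move=> i j; exact: (measurable_mx_entry (i, j)). Qed.

Lemma mxmeasurable_rinv (R : realType) n p (e : R) :
  mxmeasurable (fun A : 'M[R]_(n, p) => rinv e A).
Proof.
apply: mxmeasurable_inv; apply: mxmeasurableD; last exact: mxmeasurable_cst.
by apply: mxmeasurableM; [apply: mxmeasurable_tr|]; exact: mxmeasurable_id.
Qed.

Lemma mxmeasurable_efron_morris (R : realType) n p :
  mxmeasurable (@efron_morris R n p).
Proof.
apply: mxmeasurableM; first exact: mxmeasurable_id.
apply: mxmeasurableD; first exact: mxmeasurable_cst.
have -> : (fun A : 'M[R]_(n, p) => - ((n%:R - p%:R - 1) *: invmx (A^T *m A))) =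
    (fun A => - (n%:R - p%:R - 1) *: invmx (A^T *m A)).
  by apply/funext => A; rewrite scaleNr.
apply: mxmeasurableZ => //; apply: mxmeasurable_inv.
by apply: mxmeasurableM; [apply: mxmeasurable_tr|]; exact: mxmeasurable_id.
Qed.

Lemma measurable_efron_morris (R : realType) n p :
  measurable_fun setT (@efron_morris R n p).
Proof.
apply: measurable_fun_mxP => -[i j].
exact: mxmeasurable_efron_morris.
Qed.

(** * Risk of the regularized estimator *)

Section regularized_risk.
Context {R : realType} {n p : nat} (mu : 'M[R]_(n, p) -> probability 'M[R]_(n, p) R).
Hypothesis mu_law : forall M, normal_law M (mu M).
Variables (e : R) (c : 'cV[R]_p).
Hypothesis e0 : 0 < e.
Implicit Types M A : 'M[R]_(n, p).

(** The direction in which Stein's identity is applied: its inner product with [A] is the coordinate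
    [a] of [A *m c]. *)
Definition row_dir (a : 'I_n) : 'M[R]_(n, p) := (delta_mx a 0 : 'cV[R]_n) *m c^T.

Lemma row_dirE a i j : row_dir a i j = (i == a)%:R * c j 0.
Proof. by rewrite /row_dir mxE big_ord1 !mxE eqxx andbT. Qed.

Lemma mxdot_row_dir a A : mxdot (row_dir a) A = (A *m c) a 0.
Proof.
rewrite /mxdot -(pair_bigA _ (fun i j => mx_entry (i, j) (row_dir a) * mx_entry (i, j) A)) /=.
rewrite (bigD1 a)//= [X in _ + X]big1 ?addr0 => [|i ia].
  by rewrite mxE; apply: eq_bigr => j _; rewrite /mx_entry/= row_dirE eqxx mul1r mulrC.
by apply: big1 => j _; rewrite /mx_entry/= row_dirE (negPf ia) !mul0r.
Qed.

Lemma mxdot_row_dir_self a : mxdot (row_dir a) (row_dir a) = sqnorm c.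
Proof.
rewrite mxdot_row_dir sqnormE mxE; apply: eq_bigr => j _.
by rewrite row_dirE eqxx mul1r expr2.
Qed.

Let quad A : R := (c^T *m rinv e A *m c) 0 0.
Let shrink a A : R := (A *m rinv e A *m c) a 0.

Lemma mul_rinv_slope_row_dir a A :
  (mul_rinv_slope e (row_dir a) A *m c) a 0 = rdiv e c a A.
Proof.
pose q : 'M[R]_1 := c^T *m rinv e A *m c.
pose s : 'M[R]_1 := ((delta_mx a 0 : 'cV[R]_n)^T *m (A *m rinv e A *m c)).
have -> : mul_rinv_slope e (row_dir a) A *m c =
    (delta_mx a 0 : 'cV[R]_n) *m q - (A *m rinv e A *m c) *m s
    - (A *m rinv e A *m A^T *m (delta_mx a 0 : 'cV[R]_n)) *m q.
  rewrite /mul_rinv_slope /gram_slope /row_dir /q /s mulmxBl !mulmxDr !mulmxDl.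
  by rewrite opprD addrA trmx_mul trmxK !mulmxA.
rewrite /rdiv -/q /s trmx_delta -colE -rowE.
rewrite [q]mx11_scalar !mul_mx_scalar !mxE !big_ord1 !mxE !eqxx /=.
rewrite mulr1n mulr1; ring.
Qed.

Lemma measurable_shrink a : measurable_fun setT (shrink a).
Proof.
apply: (_ : mxmeasurable (fun A => A *m rinv e A *m c)).
apply: mxmeasurableM; last exact: mxmeasurable_cst.
by apply: mxmeasurableM; [exact: mxmeasurable_id|exact: mxmeasurable_rinv].
Qed.

Lemma measurable_quad : measurable_fun setT quad.
Proof.
apply: (_ : mxmeasurable (fun A : 'M[R]_(n, p) => c^T *m rinv e A *m c)).
apply: mxmeasurableM; last exact: mxmeasurable_cst.
by apply: mxmeasurableM; [exact: mxmeasurable_cst|exact: mxmeasurable_rinv].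
Qed.

Lemma measurable_rdiv (a : 'I_n) :
  measurable_fun setT (rdiv e c a : 'M[R]_(n, p) -> R).
Proof.
apply: measurable_funB; last by apply: measurable_funX; exact: measurable_shrink.
apply: measurable_funM; first exact: measurable_quad.
apply: measurable_funB => //.
apply: (_ : mxmeasurable (fun A : 'M[R]_(n, p) => A *m rinv e A *m A^T)).
apply: mxmeasurableM; last by apply: mxmeasurable_tr; exact: mxmeasurable_id.
by apply: mxmeasurableM; [exact: mxmeasurable_id|exact: mxmeasurable_rinv].
Qed.

Lemma shrink_rdiv_bounded : exists B,
  forall A, `|quad A| <= B /\
    forall a, `|shrink a A| <= B /\ `|rdiv e c a A| <= B.
Proof.
have [bB bp bh] := @rinv_bounded R n p e e0 _ (fun=> True) id.
have bc := @mxbounded_cst R 'M[R]_(n, p) (fun=> True) _ _ c.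
have bcT := @mxbounded_cst R 'M[R]_(n, p) (fun=> True) _ _ c^T.
have [Bf Hf] := mxboundedM bp bc.
have [Bq Hq] := mxboundedM (mxboundedM bcT bB) bc.
have [Bh Hh] := bh.
exists (Bq + (`|Bf| + Bq * (1 + `|Bh|) + `|Bf| ^+ 2)) => A.
have {}Hq : `|quad A| <= Bq := Hq A I 0 0.
have Bq0 : 0 <= Bq := le_trans (normr_ge0 _) Hq.
split; first by rewrite (le_trans Hq)// lerDl !addr_ge0 ?mulr_ge0 ?addr_ge0 ?sqr_ge0.
move=> a.
have {Hf} : `|shrink a A| <= `|Bf| := le_trans (Hf A I a 0) (ler_norm _).
have {Hh} : `|(A *m rinv e A *m A^T) a a| <= `|Bh| := le_trans (Hh A I a a) (ler_norm _).
have := normr_ge0 Bh; have := normr_ge0 Bf.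
move: `|Bf| `|Bh| => {}Bf {}Bh Bf0 Bh0 Hh Hf.
have qh : `|quad A * (1 - (A *m rinv e A *m A^T) a a)| <= Bq * (1 + Bh).
  rewrite normrM ler_pM// (le_trans (ler_normB _ _))// normr1 lerD2l//.
have f2 : `|shrink a A ^+ 2| <= Bf ^+ 2 by rewrite normrX ler_pXn2r// nnegrE.
have Bqh : 0 <= Bq * (1 + Bh) by rewrite mulr_ge0// addr_ge0.
have Bf2 := sqr_ge0 Bf.
split; first lra.
rewrite (le_trans (ler_normB _ _))// -/(quad A) -/(shrink a A); lra.
Qed.

(** Stein's identity along [row_dir a]. The Taylor constant is multiplied by the sum of the
    [|c j 0|] because the matrix expansion is applied to [c]. *)
Lemma stein_shrink M a :
  \int[mu M]_A (shrink a A * ((A - M) *m c) a 0) = \int[mu M]_A rdiv e c a A.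
Proof.
have [B HB] := shrink_rdiv_bounded; have [C HC] := mul_rinv_taylor e0 (row_dir a).
rewrite -(@stein_identity R n p mu mu_law M (row_dir a) (shrink a) (rdiv e c a) B
    (C * \sum_j `|c j 0|)).
- by apply: eq_Rintegral => A _; rewrite mxdot_row_dir.
- exact: measurable_shrink.
- exact: measurable_rdiv.
- by move=> A; have [] := (HB A).2 a.
- by move=> A; have [] := (HB A).2 a.
move=> A t t0 t1; rewrite -mul_rinv_slope_row_dir /shrink.
set F := (X in X *m c); set G := (X in _ - (X *m c) a 0 - _); set H := mul_rinv_slope _ _ _.
have linE (F' G' H' : 'M[R]_(n, p)) :
    (F' *m c) a 0 - (G' *m c) a 0 - t * (H' *m c) a 0 = ((F' - G' - t *: H') *m c) a 0.
  by rewrite !mulmxBl -scalemxAl !mxE.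
rewrite linE.
rewrite mxE (le_trans (ler_norm_sum _ _ _))// mulrAC mulr_sumr; apply: ler_sum => j _.
by rewrite normrM ler_wpM2r// HC.
Qed.

(** The loss along [c] of the estimator [A - k *: (A *m rinv e A)], in which [rinv e A] replaces the
    inverse Gram matrix. *)
Definition shrink_loss (k : R) M A : R :=
  sqnorm ((A - M) *m c - k *: (A *m rinv e A *m c)).

Lemma measurable_shrink_loss k M : measurable_fun setT (shrink_loss k M).
Proof.
apply: measurable_sqnorm.
apply: mxmeasurableD.
  apply: mxmeasurableM; last exact: mxmeasurable_cst.
  by apply: mxmeasurableD; [exact: mxmeasurable_id|exact: mxmeasurable_cst].
under eq_fun do rewrite -scaleNr.
apply: mxmeasurableZ => // i j; rewrite ord1; exact: measurable_shrink.
Qed.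

(** Expand the square. The noise term is at most [n * sqnorm c]; the cross term is [- 2 * k] times
    the mean divergence by Stein, hence at most [- 2 * k ^+ 2] times the mean of [quad]; the last
    term is at most [k ^+ 2] times that mean. *)
Lemma shrink_risk_le M (k := n%:R - p%:R - 1 : R) : 0 <= k ->
  [/\ rintegrable (mu M) (shrink_loss k M), rintegrable (mu M) quad &
    \int[mu M]_A shrink_loss k M A + k ^+ 2 * \int[mu M]_A quad A <= n%:R * sqnorm c].
Proof.
move=> k0; have [B HB] := shrink_rdiv_bounded.
pose Y a A := ((A - M) *m c) a 0.
have YE a : Y a = (fun A => mxdot (row_dir a) (A - M)).
  by apply/funext => A; rewrite mxdot_row_dir.
have mY a : measurable_fun setT (Y a).
  by rewrite YE; exact: measurable_mxdot_centered.
have Y2i a : rintegrable (mu M) (fun A => Y a A ^+ 2).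
  by rewrite YE; exact: rintegrable_sqr_mxdot.
have Y2 a : \int[mu M]_A (Y a A ^+ 2) <= sqnorm c.
  rewrite -(mxdot_row_dir_self a); rewrite YE.
  exact: rintegral_sqr_mxdot_le.
have Yi a : rintegrable (mu M) (Y a).
  apply: rintegrable_le (rintegrableD (rintegrable_cst _ 1) (Y2i a)) => //.
  by move=> A /=; exact: ler_norm_onesqr.
have fYi a : rintegrable (mu M) (fun A => shrink a A * Y a A).
  apply: (@rintegrable_bounded_mul _ _ _ _ _ _ B) => //; first exact: measurable_shrink.
  by move=> A; have [] := (HB A).2 a.
have f2i a : rintegrable (mu M) (fun A => shrink a A ^+ 2).
  apply: (@rintegrable_bounded _ _ _ _ _ (B ^+ 2)).
    by apply: measurable_funX; exact: measurable_shrink.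
  move=> A; have [h _] := (HB A).2 a; rewrite normrX ler_pXn2r// nnegrE//.
  exact: le_trans h.
have lossE A : shrink_loss k M A =
    \sum_a (Y a A ^+ 2 + (- (2 * k) * (shrink a A * Y a A) + k ^+ 2 * shrink a A ^+ 2)).
  rewrite /shrink_loss sqnormE; apply: eq_bigr => a _.
  by rewrite !mxE -/(Y a A) -/(shrink a A) /Y /shrink !mxE; ring.
have qi : rintegrable (mu M) quad.
  apply: (rintegrable_bounded _ measurable_quad (r := B)) => A.
  exact: (HB A).1.
have di a : rintegrable (mu M) (rdiv e c a).
  by apply: (rintegrable_bounded _ (measurable_rdiv a) (r := B)) => A; have [] := (HB A).2 a.
have g1i a : rintegrable (mu M) (fun A => - (2 * k) * (shrink a A * Y a A)).
  exact: rintegrableZ.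
have g2i a : rintegrable (mu M) (fun A => k ^+ 2 * shrink a A ^+ 2).
  exact: rintegrableZ.
have gi a := rintegrableD (Y2i a) (rintegrableD (g1i a) (g2i a)).
have lossi : rintegrable (mu M) (shrink_loss k M).
  have -> : shrink_loss k M = _ := funext lossE.
  exact: rintegrable_sum.
split => //.
have -> : \int[mu M]_A shrink_loss k M A = \sum_a \int[mu M]_A (Y a A ^+ 2)
    + (- (2 * k) * \int[mu M]_A (\sum_a rdiv e c a A)
       + k ^+ 2 * \int[mu M]_A sqnorm (A *m rinv e A *m c)).
  under eq_Rintegral do rewrite lossE.
  rewrite Rintegral_sum//.
  have -> : \int[mu M]_A sqnorm (A *m rinv e A *m c) = \sum_a \int[mu M]_A (shrink a A ^+ 2).
    by under eq_Rintegral do rewrite sqnormE; rewrite Rintegral_sum.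
  rewrite Rintegral_sum// !mulr_sumr -!big_split /=; apply: eq_bigr => a _.
  rewrite (rintegralD (Y2i a) (rintegrableD (g1i a) (g2i a))).
  rewrite (rintegralD (g1i a) (g2i a)) (rintegralZ _ (fYi a)) (rintegralZ _ (f2i a)).
  by rewrite stein_shrink.
have i1 : rintegrable (mu M) (fun A => sqnorm (A *m rinv e A *m c)).
  by under eq_fun do rewrite sqnormE; exact: rintegrable_sum.
have h1 : \int[mu M]_A sqnorm (A *m rinv e A *m c) <= \int[mu M]_A quad A.
  by apply: le_rintegral => // A; exact: sqnorm_mul_rinv_le.
have h2 : k * \int[mu M]_A quad A <= \int[mu M]_A (\sum_a rdiv e c a A).
  rewrite -rintegralZ//; apply: le_rintegral; first exact: rintegrableZ.
    exact: rintegrable_sum.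
  by move=> A; exact: sum_rdiv_ge.
have h3 : \sum_a \int[mu M]_A (Y a A ^+ 2) <= n%:R * sqnorm c.
  rewrite mulr_natl -[X in _ *+ X](card_ord n) -sumr_const.
  by apply: ler_sum => a _; exact: Y2.
have k2 := sqr_ge0 k.
have h4 : k ^+ 2 * \int[mu M]_A sqnorm (A *m rinv e A *m c) <= k ^+ 2 * \int[mu M]_A quad A.
  exact: ler_wpM2l.
have h5 : 2 * k * (k * \int[mu M]_A quad A) <= 2 * k * \int[mu M]_A (\sum_a rdiv e c a A).
  by apply: ler_wpM2l => //; rewrite mulr_ge0.
have -> : k ^+ 2 * \int[mu M]_A quad A =
    2 * k * (k * \int[mu M]_A quad A) - k ^+ 2 * \int[mu M]_A quad A.
  by ring.
lra.
Qed.

End regularized_risk.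

Lemma limn_einf_le (R : realType) (u : (\bar R)^nat) (x : \bar R) :
  (forall m, u m <= x)%E -> (limn_einf u <= x)%E.
Proof.
move=> ux; rewrite limn_einf_lim; apply: lime_le; first exact: is_cvg_einfs.
apply: nearW => m; apply: le_trans (ux m); apply: ereal_inf_lbound.
by exists m => /=.
Qed.

(** * Behaviour of the regularized inverse for small regularization *)

Section rinv_singular.
Context {R : realFieldType} {n p : nat} (e : R).
Hypothesis e0 : 0 < e.

(* If X w = 0 with w != 0 then rinv X w = w / e; completing the square bounds
   each diagonal entry of rinv X below by w_i^2 / (e |w|^2). *)
Lemma mxtrace_rinv_singular (X : 'M[R]_(n, p)) :
  X^T *m X \notin unitmx -> e^-1 <= \tr (rinv e X).
Proof.
rewrite unitmxE unitfE negbK => /det0P[v v0 vS].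
have [w Sw w0] : exists2 w : 'cV[R]_p, X^T *m X *m w = 0 & 0 < sqnorm w.
  exists v^T; first by apply: trmx_inj; rewrite trmx_mul trmxK trmx_mul trmxK vS trmx0.
  rewrite lt_neqAle sqnorm_ge0 andbT eq_sym; apply: contra v0 => /eqP/sqnorm_eq0 w0.
  by rewrite -(trmxK v) w0 trmx0.
have Bw : rinv e X *m w = e^-1 *: w.
  have : rgram e X *m w = e *: w by rewrite /rgram mulmxDl Sw add0r mul_scalar_mx.
  move=> /(congr1 (fun z => e^-1 *: (rinv e X *m z))).
  by rewrite mulKmx ?rgram_unit// -scalemxAr scalerA mulVf ?gt_eqF// scale1r => ->.
have diag i : w i 0 ^+ 2 / (e * sqnorm w) <= rinv e X i i.
  (* This [s] minimizes the quadratic form of [rinv e X] along the line [u - s *: w]. *)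
  pose s := w i 0 / sqnorm w; pose u : 'cV[R]_p := delta_mx i 0.
  have := rinv_form_ge0 e0 X (u - s *: w).
  have -> : (u - s *: w)^T *m rinv e X *m (u - s *: w) =
      u^T *m rinv e X *m u - s *: (u^T *m (rinv e X *m w))
      - s *: ((rinv e X *m w)^T *m u) + s *: (s *: (w^T *m (rinv e X *m w))).
    have -> : (u - s *: w)^T = u^T - s *: w^T by apply/matrixP => k l; rewrite !mxE.
    rewrite trmx_mul tr_rinv !(mulmxBl, mulmxBr).
    rewrite -?scalemxAl -?scalemxAr -?scalemxAl !mulmxA.
    by apply/matrixP => k l; rewrite !mxE; ring.
  rewrite Bw [(e^-1 *: w)^T]linearZ /= -?scalemxAr -?scalemxAl.
  have uw : u^T *m w = (w i 0)%:M.
    by rewrite /u trmx_delta -rowE; apply/matrixP => k l; rewrite !ord1 !mxE mulr1n.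
  have wu : w^T *m u = (w i 0)%:M.
    by apply: trmx_inj; rewrite trmx_mul trmxK uw tr_scalar_mx.
  have ww : w^T *m w = (sqnorm w)%:M by rewrite [LHS]mx11_scalar.
  have uBu : u^T *m rinv e X *m u = (rinv e X i i)%:M.
    rewrite /u trmx_delta -mulmxA -rowE -colE.
    by apply/matrixP => k l; rewrite !ord1 !mxE mulr1n.
  rewrite uw wu ww uBu !mxE !mulr1n /s => h.
  rewrite -subr_ge0; apply: (le_trans h); rewrite le_eqVlt; apply/orP; left.
  by apply/eqP; field; rewrite !gt_eqF.
apply: (@le_trans _ _ (\sum_i w i 0 ^+ 2 / (e * sqnorm w))); last exact: ler_sum.
rewrite -mulr_suml -sqnormE le_eqVlt; apply/orP; left.
by apply/eqP; field; rewrite !gt_eqF.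
Qed.

(** The resolvent identity used twice. The factor [e] is explicit and [e *: rinv e X] is bounded, so
    for fixed [X] the difference is of order [e]. *)
Lemma rinv_sub_inv (X : 'M[R]_(n, p)) (S := X^T *m X) : S \in unitmx ->
  rinv e X - invmx S =
  e *: ((e *: rinv e X) *m (invmx S *m invmx S) - invmx S *m invmx S).
Proof.
move=> uS; have BS : rinv e X *m S = 1%:M - e *: rinv e X.
  by rewrite /S (gramE e) mulmxBr mulVmx ?rgram_unit// mul_mx_scalar.
have B1 : rinv e X = invmx S - e *: (rinv e X *m invmx S).
  by rewrite -[LHS](mulmxK uS) BS mulmxBl mul1mx -scalemxAl.
have B2 : rinv e X *m invmx S = invmx S *m invmx S - e *: (rinv e X *m (invmx S *m invmx S)).
  by rewrite {1}B1 mulmxBl -scalemxAl mulmxA.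
rewrite {1}B1 addrAC subrr add0r {1}B2 -scalemxAl.
by rewrite scalerBr scalerBr opprB.
Qed.

End rinv_singular.

(** * Almost sure invertibility and passage to the limit *)

Section efron_morris_risk.
Context {R : realType} {n p : nat} (mu : 'M[R]_(n, p) -> probability 'M[R]_(n, p) R).
Hypothesis mu_law : forall M, normal_law M (mu M).
Implicit Types M A : 'M[R]_(n, p).
Let k : R := n%:R - p%:R - 1.
Hypothesis k0 : 0 < k.

Definition singular : set 'M[R]_(n, p) := [set A | A^T *m A \notin unitmx].

Lemma measurable_singular : measurable singular.
Proof.
have mdet : measurable_fun setT (fun A : 'M[R]_(n, p) => \det (A^T *m A)).
  apply: measurable_det; apply: mxmeasurableM; last exact: mxmeasurable_id.
  by apply: mxmeasurable_tr; exact: mxmeasurable_id.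
rewrite (_ : singular = (fun A : 'M[R]_(n, p) => \det (A^T *m A)) @^-1` [set 0]).
  by rewrite -[_ @^-1` _]setTI; exact: mdet.
by apply/seteqP; split => A; rewrite /singular /= unitmxE unitfE negbK => /eqP.
Qed.

(* The bound on the risk of the regularized estimators also bounds
   [E tr (rinv e A)] independently of e, whereas [tr (rinv e A) >= 1 / e] on
   singular Gram matrices. *)
Lemma singular_null M : mu M singular = 0%E.
Proof.
have mS := measurable_singular.
(* [shrink_risk_le] at a basis vector bounds the mean of a diagonal entry of [rinv e A] by
   [n / k ^+ 2], and there are [p] such entries. *)
pose K : R := p%:R * (n%:R / k ^+ 2).
have K0 : 0 <= K by rewrite mulr_ge0// divr_ge0// sqr_ge0.
suff key e : 0 < e -> (mu M singular <= (e * K)%:E)%E.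
  apply/eqP; rewrite eq_le measure_ge0 andbT; apply/lee_addgt0Pr => e e0.
  rewrite add0e; apply: (le_trans (key (e / (K + 1)) _)).
    by rewrite divr_gt0// ltr_wpDl.
  rewrite lee_fin mulrAC ler_pdivrMr ?ltr_wpDl// ler_wpM2l ?(ltW e0)//; lra.
move=> e0; pose tr A := \tr (rinv e A).
have tri : rintegrable (mu M) tr /\ \int[mu M]_A tr A <= K.
  pose u i : 'cV[R]_p := delta_mx i 0.
  have H i := shrink_risk_le mu_law (u i) e0 M (ltW k0).
  have trE A : tr A = \sum_i ((u i)^T *m rinv e A *m u i) 0 0.
    apply: eq_bigr => i _; rewrite /u trmx_delta -mulmxA -rowE -colE.
    by rewrite !mxE.
  have -> : tr = _ := funext trE.
  split; first by apply: rintegrable_sum => i; have [] := H i.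
  rewrite Rintegral_sum; last by move=> i; have [] := H i.
  rewrite /K mulr_natl -[X in _ *+ X](card_ord p) -sumr_const; apply: ler_sum => i _.
  have [_ _] := H i; rewrite (_ : sqnorm (u i) = 1); last first.
    rewrite sqnormE (bigD1 i)//= big1 ?addr0 => [|j ji]; first by rewrite mxE !eqxx expr1n.
    by rewrite mxE (negPf ji) expr0n.
  rewrite mulr1 -/k => h; rewrite ler_pdivlMr ?exprn_gt0// mulrC.
  apply: le_trans h; rewrite lerDr.
  by apply: Rintegral_ge0 => A _; exact: sqnorm_ge0.
have [ti tK] := tri.
rewrite -[singular]setIT -integral_indic//.
apply: (@le_trans _ _ (\int[mu M]_A (e * tr A)%:E)%E).
  apply: ge0_le_integral => //.
  - by apply/measurable_EFinP; exact: measurable_indic.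
  - apply/measurable_EFinP; apply: measurable_funM => //.
    exact: measurable_rintegrable ti.
  - move=> A _; rewrite lee_fin indicE.
    have [/set_mem AS|AS] := boolP (A \in singular) => /=; last first.
      by rewrite mulr_ge0 ?(ltW e0)// mxtrace_rinv_ge0.
    rewrite -(@mulfV _ e) ?gt_eqF// ler_wpM2l ?(ltW e0)//.
    exact: mxtrace_rinv_singular.
rewrite integral_EFin_Rintegral; last exact: rintegrableZ.
by rewrite lee_fin rintegralZ// ler_wpM2l ?(ltW e0).
Qed.

Lemma efron_morris_mul (c : 'cV[R]_p) M A :
  (efron_morris A - M) *m c = (A - M) *m c - k *: (A *m invmx (A^T *m A) *m c).
Proof.
rewrite /efron_morris mulmxBr mulmx1 -scalemxAr -/k !mulmxBl -scalemxAl.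
by rewrite addrAC.
Qed.

Lemma loss_form (c : 'cV[R]_p) (M N : 'M[R]_(n, p)) :
  (c^T *m mx_quadratic_loss M N *m c) 0 0 = sqnorm ((N - M) *m c).
Proof. by rewrite /sqnorm /mx_quadratic_loss trmx_mul !mulmxA. Qed.

(** By [rinv_sub_inv] the error vectors differ by [k * e m] times a vector bounded in [m], so the
    losses differ by at most [C * e m]. *)
Lemma shrink_loss_cvg (c : 'cV[R]_p) M A : ~ singular A ->
  (shrink_loss (m.+1%:R^-1) c k M A)%:E @[m --> \oo] --> (sqnorm ((efron_morris A - M) *m c))%:E.
Proof.
move=> /negP; rewrite negbK => uS.
pose S2 := invmx (A^T *m A) *m invmx (A^T *m A).
pose e m : R := m.+1%:R^-1.
have e0 m : 0 < e m by rewrite invr_gt0.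
have e1 m : e m <= 1 by rewrite invf_le1// ler1n.
pose r m := A *m ((e m *: rinv (e m) A) *m S2 - S2) *m c.
have [K rK] : mxbounded (fun=> True) r.
  apply: mxboundedM; last exact: mxbounded_cst.
  apply: mxboundedM; first exact: mxbounded_cst.
  apply: mxboundedB; last exact: mxbounded_cst.
  apply: mxboundedM; last exact: mxbounded_cst.
  exists 1 => m _ i j; rewrite mxE normrM gtr0_norm// -(@mulfV _ (e m)) ?gt_eqF//.
  by rewrite ler_wpM2l ?(ltW (e0 m))// rinv_bound.
pose z := (efron_morris A - M) *m c.
have lossE m : shrink_loss (e m) c k M A = \sum_i (z i 0 - k * (e m * r m i 0)) ^+ 2.
  rewrite /shrink_loss; set x := (_ - _); have -> : x = z - k *: (e m *: r m).
    rewrite /x /z efron_morris_mul -[in LHS](subrK (invmx (A^T *m A)) (rinv (e m) A)).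
    rewrite (rinv_sub_inv (e0 m) uS) mulmxDr mulmxDl -/S2 scalerDr opprD addrA addrAC.
    have lin (Y : 'M[R]_p) : A *m (e m *: Y) *m c = e m *: (A *m Y *m c).
      by rewrite -scalemxAr -scalemxAl.
    by rewrite lin.
  by rewrite sqnormE; apply: eq_bigr => i _; rewrite !mxE.
pose C := \sum_i (k * `|K| * (k * `|K| + 2 * `|z i 0|)).
have bound m : `|shrink_loss (e m) c k M A - sqnorm z| <= C * e m.
  rewrite lossE sqnormE -sumrB /C mulr_suml; apply: (le_trans (ler_norm_sum _ _ _)).
  apply: ler_sum => i _.
  have ri : `|r m i 0| <= `|K| := le_trans (rK m Logic.I i 0) (ler_norm _).
  rewrite (_ : _ - _ = (k * r m i 0 * e m) * (k * r m i 0 * e m - 2 * z i 0)); last by ring.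
  have kr : `|k * r m i 0 * e m| <= k * `|K| * e m.
    by rewrite !normrM (gtr0_norm k0) (gtr0_norm (e0 m)) ler_wpM2r ?(ltW (e0 m))//
      ler_wpM2l ?(ltW k0).
  rewrite normrM [leRHS]mulrAC ler_pM// (le_trans (ler_normB _ _))//.
  rewrite lerD//; last by rewrite normrM gtr0_norm.
  by rewrite (le_trans kr)// ler_piMr// mulr_ge0// ltW.
apply/cvg_EFin; first by apply: nearW.
rewrite (_ : fine \o _ = (fun m => shrink_loss (e m) c k M A))//.
have hC : (fun m => C * e m) @ \oo --> (0 : R).
  by rewrite -[X in _ --> X](mulr0 C); apply: cvgMr; exact: cvg_harmonic.
apply: (@squeeze_cvgr _ _ _ _ (fun m => sqnorm z - C * e m) (fun m => sqnorm z + C * e m)).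
- by apply: nearW => m; rewrite -ler_distlC distrC bound.
- by rewrite -[X in _ --> X]subr0; apply: cvgB => //; exact: cvg_cst.
- by rewrite -[X in _ --> X]addr0; apply: cvgD => //; exact: cvg_cst.
Qed.

(** Off the null set [singular] the loss is the limit of regularized losses, whose risks share the
    bound; Fatou's lemma concludes. *)
Lemma efron_morris_risk_le (c : 'cV[R]_p) M :
  (\int[mu M]_A (sqnorm ((efron_morris A - M) *m c))%:E <= (n%:R * sqnorm c)%:E)%E.
Proof.
have mS := measurable_singular.
have me m : measurable_fun setT (fun A => (shrink_loss (m.+1%:R^-1) c k M A)%:E).
  by apply/measurable_EFinP; exact: measurable_shrink_loss.
have mem : measurable_fun setT (fun A : 'M[R]_(n, p) => (sqnorm ((efron_morris A - M) *m c))%:E).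
  apply/measurable_EFinP; apply: measurable_sqnorm.
  apply: mxmeasurableM; last exact: mxmeasurable_cst.
  by apply: mxmeasurableD; [exact: mxmeasurable_efron_morris|exact: mxmeasurable_cst].
rewrite (ge0_negligible_integral mS _ _ _ (singular_null M))//; last first.
  by move=> A _; rewrite lee_fin sqnorm_ge0.
have mD : measurable (setT `\` singular) by exact: measurableD.
rewrite (eq_integral (fun A => limn_einf (fun m =>
    (shrink_loss (m.+1%:R^-1) c k M A)%:E))); last first.
  by move=> A; rewrite inE => -[_ AS]; rewrite (cvg_limn_einf_sup (@shrink_loss_cvg c M A AS)).
apply: (le_trans (fatou _ mD _ _)).
- by move=> m; exact: measurable_funTS.
- by move=> m A _; rewrite lee_fin sqnorm_ge0.
apply: limn_einf_le => m.
have m0 : 0 < m.+1%:R^-1 :> R by rewrite invr_gt0.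
have [i1 i2 h] := shrink_risk_le mu_law c m0 M (ltW k0).
apply: (@le_trans _ _ (\int[mu M]_A (shrink_loss (m.+1%:R^-1) c k M A)%:E)%E).
  apply: ge0_subset_integral => //.
  by move=> A _; rewrite lee_fin sqnorm_ge0.
rewrite integral_EFin_Rintegral// lee_fin; apply: le_trans h; rewrite lerDl.
rewrite mulr_ge0 ?sqr_ge0// Rintegral_ge0// => A _; exact: rinv_form_ge0.
Qed.

End efron_morris_risk.

(** * Lower bound for the minimax risk *)

(* Average the hypothesis over the points of the box [sum_a t_a u_a] with
   [0 <= t_a <= N + 1]: the sum telescopes along each direction, leaving only
   boundary terms, whose proportion is [1 / (N + 2)]. *)
Lemma no_uniform_descent (R : archiRealFieldType) (V : zmodType) (n : nat)
    (u : 'I_n -> V) (b : 'I_n -> V -> R) (B delta : R) :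
  0 < delta -> (forall a x, `|b a x| <= B) ->
  ~ (forall x, \sum_a (b a (x + u a) - b a x) <= - delta).
Proof.
move=> delta0 bB H.
have [N NB] : exists N, 2 * B * n%:R < delta * N.+2%:R.
  have := archi_boundP (normr_ge0 (2 * B * n%:R / delta)).
  set N := Num.bound _ => hN; exists N.
  have := le_lt_trans (ler_norm _) hN; rewrite ltr_pdivrMr// mulrC => /lt_le_trans; apply.
  by rewrite mulrC ler_wpM2l ?(ltW delta0)// ler_nat -addn2 leq_addr.
(* Box points are indexed by functions into the cyclic group ['I_N.+2], so that a step in direction
   [a] permutes them; it wraps around only on the face [t a = m]. *)
pose T := {ffun 'I_n -> 'I_N.+2}.
pose pt (t : T) : V := \sum_a u a *+ t a.
pose step a (k : 'I_N.+2) : T := [ffun i => if i == a then k else 0].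
pose m : 'I_N.+2 := ord_max.
(* The slices [t a = k] are translates of one another, so the top face holds a fraction
   [1 / (N + 2)] of the box. *)
have card_top a : \sum_(t : T) (t a == m)%:R * N.+2%:R = #|{: T}|%:R :> R.
  rewrite -mulr_suml.
  have const k : \sum_(t : T) (t a == k)%:R = \sum_(t : T) (t a == m)%:R :> R.
    rewrite (reindex_inj (addIr (step a (k - m)))) /=; apply: eq_bigr => t _.
    by rewrite !ffunE eqxx -[t a == m](inj_eq (addIr (k - m))) [m + _]addrC subrK.
  transitivity (\sum_(k < N.+2) \sum_(t : T) (t a == k)%:R : R).
    under [RHS]eq_bigr do rewrite const.
    by rewrite [RHS]sumr_const card_ord mulr_natr.
  rewrite exchange_big /= -sumr_const; apply: eq_bigr => t _.
  by rewrite (bigD1 (t a))//= eqxx big1 ?addr0// => k /negPf kt; rewrite eq_sym kt.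
have pt_step a (t : {ffun 'I_n -> 'I_N.+2}) : t a != m -> pt (t + step a 1) = pt t + u a.
  move=> tm; rewrite /pt (bigD1 a)//= [in RHS](bigD1 a)//= !ffunE eqxx.
  rewrite addrAC -mulrSr; congr (u a *+ _ + _).
    have tN : (t a < N.+1)%N by rewrite ltn_neqAle -ltnS ltn_ord andbT.
    by rewrite -[LHS]/((t a + 1 %% N.+2) %% N.+2)%N [(1 %% _)%N]modn_small// addn1 modn_small.
  by apply: eq_bigr => i /negPf ia; rewrite !ffunE ia addr0.
(* Reindexing by the cyclic step cancels every term off the top face, and each remaining term is at
   least [- (2 * B)]. *)
have dir a : - (2 * B) * \sum_(t : T) (t a == m)%:R <=
    \sum_(t : T) (b a (pt t + u a) - b a (pt t)).
  rewrite sumrB [X in _ - X](reindex_inj (addIr (step a 1))) /= -sumrB mulr_sumr.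
  apply: ler_sum => t _; have [tm|tm] := eqVneq (t a) m; last first.
    by rewrite mulr0 pt_step// subrr.
  rewrite mulr1; have := bB a (pt t + u a); have := bB a (pt (t + step a 1)).
  by rewrite !ler_norml => /andP[? ?] /andP[? ?]; lra.
have T0 : 0 < #|{: T}|%:R :> R by rewrite ltr0n; apply/card_gt0P; exists 0.
have tot : - (2 * B) * n%:R * #|{: T}|%:R <= - delta * #|{: T}|%:R * N.+2%:R.
  have -> : - (2 * B) * n%:R * #|{: T}|%:R =
      (\sum_a - (2 * B) * \sum_(t : T) (t a == m)%:R) * N.+2%:R.
    rewrite mulr_suml (eq_bigr (fun=> - (2 * B) * #|{: T}|%:R)) => [|a _].
      by rewrite sumr_const card_ord -mulr_natr; ring.
    by rewrite -mulrA mulr_suml card_top.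
  rewrite ler_wpM2r//; apply: (le_trans (ler_sum _ (fun a _ => dir a))).
  rewrite exchange_big /= mulr_natr -sumr_const.
  by apply: ler_sum => t _; exact: H.
by have : 2 * B * n%:R * #|{: T}|%:R < delta * N.+2%:R * #|{: T}|%:R; [rewrite ltr_pM2r|lra].
Qed.

Section lower_bound.
Context {R : realType} {n p : nat} (mu : 'M[R]_(n, p) -> probability 'M[R]_(n, p) R).
Hypothesis mu_law : forall M, normal_law M (mu M).
Implicit Types M D A : 'M[R]_(n, p).

(** The squared likelihood ratio is a multiple of the exponential functional for [2 *: D]. Its mean
    is 1 plus the chi-square divergence of the two laws. *)
Lemma rintegral_shift_density_sqr M D :
  rintegrable (mu M) (fun A => shift_density M D A ^+ 2) /\
  \int[mu M]_A (shift_density M D A ^+ 2) = expR (mxdot D D).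
Proof.
have [i E] := rintegral_expR_mxdot mu_law M (2 *: D).
have dE : (fun A => shift_density M D A ^+ 2) =
    (fun A => expR (- mxdot D D) * expR (mxdot (2 *: D) (A - M))).
  apply/funext => A; rewrite /shift_density -expRM_natl -expRD mxdotZl; congr expR.
  by field.
rewrite dE; split; first exact: rintegrableZ.
by rewrite rintegralZ// E -expRD !mxdotZl mxdotZr; congr expR; field.
Qed.

Lemma rintegral_shift_density1 M D :
  rintegrable (mu M) (shift_density M D) /\ \int[mu M]_A shift_density M D A = 1.
Proof.
have [] := rintegral_shift_density mu_law (rintegrable_cst (mu (M + D)) 1).
rewrite Rintegral_cst1 (_ : (fun A => _) = shift_density M D); first by split.
by apply/funext => A; rewrite mul1r.
Qed.

Variables (c : 'cV[R]_p) (g : 'M[R]_(n, p) -> 'cV[R]_n) (r : R).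
Hypothesis mg : mxmeasurable g.
Hypothesis risk_le : forall M,
  (\int[mu M]_A (sqnorm (g A - M *m c))%:E <= r%:E)%E.
Let G a A : R := g A a 0.
Let m a M : R := (M *m c) a 0.
Let bias a M := \int[mu M]_A G a A - m a M.

Let loss_integrable M : rintegrable (mu M) (fun A => sqnorm (g A - M *m c)).
Proof.
apply/integrableP; split.
  apply/measurable_EFinP; apply: measurable_sqnorm.
  by apply: mxmeasurableD => //; exact: mxmeasurable_cst.
under eq_integral do rewrite gee0_abs ?lee_fin ?sqnorm_ge0//.
by rewrite (le_lt_trans (risk_le M))// ltry.
Qed.

Let mG a : measurable_fun setT (G a) := mg a 0.

Let coord_loss_integrable a M : rintegrable (mu M) (fun A => (G a A - m a M) ^+ 2).
Proof.
apply: rintegrable_le (loss_integrable M).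
  by apply: measurable_funX; exact: measurable_funB.
move=> A; rewrite ger0_norm ?sqr_ge0//.
by have := sqr_le_sqnorm (g A - M *m c) a; rewrite mxE [in X in _ + X]mxE.
Qed.

Let sum_coord_loss M : \sum_a \int[mu M]_A ((G a A - m a M) ^+ 2) <= r.
Proof.
rewrite -Rintegral_sum; last by move=> a; exact: coord_loss_integrable.
rewrite -lee_fin; apply: le_trans (risk_le M).
rewrite integral_EFin_Rintegral// lee_fin le_eqVlt; apply/orP; left; apply/eqP.
by apply: eq_Rintegral => A _; rewrite sqnormE; apply: eq_bigr => a _; rewrite /G /m !mxE.
Qed.

Let centered_integrable a M : rintegrable (mu M) (fun A => G a A - m a M).
Proof.
apply: rintegrable_le (rintegrableD (rintegrable_cst _ 1) (coord_loss_integrable a M)).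
  exact: measurable_funB.
by move=> A /=; exact: ler_norm_onesqr.
Qed.

Let G_integrable a M : rintegrable (mu M) (G a).
Proof.
have := rintegrableD (centered_integrable a M) (rintegrable_cst (mu M) (m a M)).
rewrite (_ : (fun A => _) = G a)//.
by apply/funext => A; rewrite subrK.
Qed.

Let r_ge0 : 0 <= r.
Proof.
rewrite -lee_fin; apply: le_trans (risk_le 0).
by apply: integral_ge0 => A _; rewrite lee_fin sqnorm_ge0.
Qed.

(** Since [|y| <= 1 + y ^+ 2], the risk bound also bounds the bias uniformly in [M], as
    [no_uniform_descent] requires. *)
Let bias_bound a M : `|bias a M| <= 1 + r.
Proof.
have -> : bias a M = \int[mu M]_A (G a A - m a M).
  by rewrite rintegralB ?Rintegral_cst1//; exact: rintegrable_cst.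
apply: (@le_trans _ _ (\int[mu M]_A (1 + (G a A - m a M) ^+ 2))).
  apply: ler_norm_rintegral => //.
    by apply: rintegrableD => //; exact: rintegrable_cst.
  by move=> A /=; exact: ler_norm_onesqr.
rewrite rintegralD//; last exact: rintegrable_cst.
rewrite Rintegral_cst1 lerD2l (le_trans _ (sum_coord_loss M))//.
rewrite (bigD1 a)//= lerDl sumr_ge0// => i _.
by apply: Rintegral_ge0 => A _; exact: sqr_ge0.
Qed.

Let v := sqnorm c.
(** Normalized so that moving the mean by [s *: U a] moves the coordinate [a] of [M *m c] by exactly
    [s]. *)
Let U a : 'M[R]_(n, p) := v^-1 *: row_dir c a.

(* A finite-difference form of the information inequality. *)
Let bias_step s a M : 0 < v -> 0 < s ->
  bias a (M + s *: U a) - bias a M <=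
  s / (2 * v) * \int[mu M]_A ((G a A - m a M) ^+ 2)
  + v / (2 * s) * (expR (s ^+ 2 / v) - 1) - s.
Proof.
move=> v0 s0; set D := s *: U a; pose h := shift_density M D.
have [hi Eh] := rintegral_shift_density1 M D.
have [h2i Eh2] := rintegral_shift_density_sqr M D.
have [Ghi EGh] := rintegral_shift_density mu_law (G_integrable a (M + D)).
have DD : mxdot D D = s ^+ 2 / v.
  rewrite /D /U !(mxdotZl, mxdotZr) mxdot_row_dir_self -/v.
  by field; rewrite gt_eqF.
have mD : m a (M + D) = m a M + s.
  rewrite /m mulmxDl mxE; congr (_ + _).
  rewrite /D /U -scalemxAl -scalemxAl !mxE.
  have -> : \sum_j row_dir c a a j * c j 0 = v.
    by rewrite /v -(mxdot_row_dir_self (n := n) c a) mxdot_row_dir mxE.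
  by field; rewrite gt_eqF.
have Xi : rintegrable (mu M) (fun A => (G a A - m a M) * (h A - 1)).
  have -> : (fun A => (G a A - m a M) * (h A - 1)) =
      (fun A => G a A * h A - G a A - (m a M * h A - m a M)).
    by apply/funext => A; ring.
  apply: rintegrableB; apply: rintegrableB => //; last exact: rintegrable_cst.
  exact: rintegrableZ.
(* [h - 1] has mean zero, so [G a] may be centered at [m a M]; the term [- s] is the displacement of
   the estimated coordinate. *)
have EX : bias a (M + D) - bias a M = \int[mu M]_A ((G a A - m a M) * (h A - 1)) - s.
  have -> : \int[mu M]_A ((G a A - m a M) * (h A - 1)) =
      \int[mu M]_A (G a A * h A - G a A - (m a M * h A - m a M)).
    by apply: eq_Rintegral => A _; ring.
  have i1 : rintegrable (mu M) (fun A => G a A * h A - G a A) by exact: rintegrableB.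
  have i3 : rintegrable (mu M) (fun A => m a M * h A) by exact: rintegrableZ.
  have i2 : rintegrable (mu M) (fun A => m a M * h A - m a M).
    by apply: rintegrableB => //; exact: rintegrable_cst.
  rewrite (rintegralB i1 i2) (rintegralB Ghi (G_integrable a M)).
  rewrite (rintegralB i3 (rintegrable_cst _ (m a M))) (rintegralZ _ hi) Eh Rintegral_cst1.
  by rewrite /bias EGh mD -/(m a M) -/h; ring.
rewrite EX lerD2r.
have h1i : rintegrable (mu M) (fun A => (h A - 1) ^+ 2).
  have -> : (fun A => (h A - 1) ^+ 2) = (fun A => h A ^+ 2 - (2 * h A - 1)).
    by apply/funext => A; ring.
  apply: rintegrableB => //; apply: rintegrableB; last exact: rintegrable_cst.
  exact: rintegrableZ.
have Eh1 : \int[mu M]_A ((h A - 1) ^+ 2) = expR (s ^+ 2 / v) - 1.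
  have -> : \int[mu M]_A ((h A - 1) ^+ 2) = \int[mu M]_A (h A ^+ 2 - (2 * h A - 1)).
    by apply: eq_Rintegral => A _; ring.
  have i1 : rintegrable (mu M) (fun A => 2 * h A) by exact: rintegrableZ.
  have i2 : rintegrable (mu M) (fun A => 2 * h A - 1).
    by apply: rintegrableB => //; exact: rintegrable_cst.
  rewrite (rintegralB h2i i2) (rintegralB i1 (rintegrable_cst _ (1 : R))) (rintegralZ _ hi).
  by rewrite Eh Eh2 DD (Rintegral_cst1 _ (1 : R)); ring.
rewrite -Eh1 -(rintegralZ _ (coord_loss_integrable a M)) -(rintegralZ _ h1i).
rewrite -(rintegralD (rintegrableZ _ (coord_loss_integrable a M)) (rintegrableZ _ h1i)).
apply: le_rintegral => //.
  by apply: rintegrableD; exact: rintegrableZ.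
move=> A; set x := G a A - m a M; set y := h A - 1.
(* Young's inequality for [x * y]: the weights [s / (2 * v)] and [v / (2 * s)] make the difference a
   perfect square up to a positive factor. *)
rewrite -subr_ge0 (_ : _ - _ = (s * x - v * y) ^+ 2 / (2 * s * v)).
  by rewrite divr_ge0 ?sqr_ge0 ?mulr_ge0 ?ltW.
by field; rewrite !gt_eqF.
Qed.

Lemma minimax_lower_bound : n%:R * sqnorm c <= r.
Proof.
rewrite leNgt; apply/negP => rv; rewrite -/v in rv.
have nv0 : 0 < n%:R * v := le_lt_trans r_ge0 rv.
have v0 : 0 < v.
  rewrite lt_neqAle sqnorm_ge0 andbT; apply: contraTneq nv0 => <-.
  by rewrite mulr0 ltxx.
have n0 : 0 < n%:R :> R by rewrite -(pmulr_lgt0 _ v0).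
pose q := r / (n%:R * v).
have q0 : 0 <= q by rewrite divr_ge0 // ltW.
have q1 : q < 1 by rewrite ltr_pdivrMr ?mul1r.
(* [x] is the value of [s ^+ 2 / v]. As [1 - q = 4 * x], positivity of [2 - q - (1 - x)^-1] amounts
   to [(1 + 4 * x) * (1 - x) > 1], which holds for [0 < x < 3 / 4]. *)
pose x := (1 - q) / 4.
have x0 : 0 < x by rewrite divr_gt0 ?subr_gt0.
have x1 : 0 < 1 - x by rewrite /x; lra.
pose s := Num.sqrt (x * v).
have s0 : 0 < s by rewrite sqrtr_gt0 mulr_gt0.
have s2 : s ^+ 2 = x * v by rewrite sqr_sqrtr// mulr_ge0 ?ltW.
have ex : expR x - 1 <= x / (1 - x).
  rewrite ler_pdivlMr//.
  have : expR x * (1 - x) <= 1.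
    rewrite -[leRHS](expRxMexpNx_1 x) ler_wpM2l ?expR_ge0//; exact: expR_ge1Dx.
  lra.
(* [- delta] is the sum over [a] of the bounds of [bias_step], with the total loss replaced by [r]
   and [expR x - 1] by [x / (1 - x)]. *)
pose delta := s / 2 * n%:R * (2 - q - (1 - x)^-1).
have delta0 : 0 < delta.
  rewrite !mulr_gt0 ?invr_gt0// -subr_gt0 subr0.
  rewrite subr_gt0 -(ltr_pM2r x1) mulVf ?gt_eqF// /x; nra.
apply: (no_uniform_descent (u := fun a => s *: U a) (b := bias) delta0 bias_bound) => M.
apply: le_trans (ler_sum _ (fun a _ => bias_step a M v0 s0)) _.
rewrite sumrB big_split /= -mulr_sumr !sumr_const card_ord.
rewrite -(mulr_natl (v / (2 * s) * (expR (s ^+ 2 / v) - 1)) n) -(mulr_natl s n).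
have h1 : s / (2 * v) * \sum_a \int[mu M]_A ((G a A - m a M) ^+ 2) <= s / (2 * v) * r.
  by rewrite ler_wpM2l ?sum_coord_loss// divr_ge0 ?mulr_ge0 ?ltW.
have h2 : v / (2 * s) * (expR (s ^+ 2 / v) - 1) <= s / 2 * (1 - x)^-1.
  have -> : s ^+ 2 / v = x by rewrite s2 mulfK ?gt_eqF.
  apply: (@le_trans _ _ (v / (2 * s) * (x / (1 - x)))).
    by rewrite ler_wpM2l// divr_ge0 ?mulr_ge0 ?(ltW v0) ?(ltW s0).
  rewrite le_eqVlt; apply/orP; left; apply/eqP.
  rewrite (_ : v / (2 * s) * (x / (1 - x)) = (x * v) / (2 * s * (1 - x))); last first.
    by field; rewrite !gt_eqF.
  by rewrite -s2; field; rewrite !gt_eqF.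
have h3 : n%:R * (v / (2 * s) * (expR (s ^+ 2 / v) - 1)) <= n%:R * (s / 2 * (1 - x)^-1).
  by rewrite ler_wpM2l.
have h4 : - delta = s / (2 * v) * r + n%:R * (s / 2 * (1 - x)^-1) - n%:R * s.
  by rewrite /delta /q; field; rewrite !gt_eqF.
rewrite h4; lra.
Qed.

End lower_bound.

(** * Assembly of the upper and lower bounds *)

Theorem theorem2p5 (R : realType) (n p : nat)
  (hn : (1 <= n)%N) (hp : (1 <= p)%N) (hnp : (0 < n - p - 1)%N)
  (d : measure_display) (T : measurableType d)
  (P : 'M[R]_(n, p) -> probability T R) (X : {mfun T >-> 'M[R]_(n, p)})
  (hX : forall M : 'M[R]_(n, p), matrix_normal (X : {RV (P M) >-> 'M[R]_(n, p)}) M) :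
  minimax P X efron_morris.
Proof.
pose mu M : probability 'M[R]_(n, p) R := distribution (P M) X.
have mu_law M : normal_law M (mu M) := matrix_normal_law (hX M).
(* [hnp] uses truncated subtraction on [nat], whereas the shrinkage factor is a difference in
   [R]. *)
have k0 : 0 < n%:R - p%:R - 1 :> R.
  move: hnp; rewrite -subnDA subn_gt0 -(ltr_nat R) natrD => h; lra.
(* The risk becomes an integral over matrix space against the law of [X], the setting of both
   bounds. *)
have riskE M delta c : measurable_fun setT delta ->
    quadratic_risk P X M delta c = (\int[mu M]_A (sqnorm (delta A *m c - M *m c))%:E)%E.
  move=> mdelta; rewrite ge0_integral_distribution; last 2 first.
  - apply/measurable_EFinP; apply: measurable_sqnorm.
    apply: mxmeasurableD; last exact: mxmeasurable_cst.
    apply: mxmeasurableM; last exact: mxmeasurable_cst.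
    by move=> i j; exact: (measurableT_comp (measurable_mx_entry (i, j)) mdelta).
  - by move=> A; rewrite lee_fin sqnorm_ge0.
  rewrite /quadratic_risk unlock; apply: eq_integral => w _ /=.
  by rewrite loss_form mulmxBl.
split; first exact: measurable_efron_morris.
move=> c; apply/eqP; rewrite eq_le; apply/andP; split; last first.
  by apply: ereal_inf_lbound; exists efron_morris => //; exact: measurable_efron_morris.
apply: (@le_trans _ _ (n%:R * sqnorm c)%:E).
  apply: ge_ereal_sup => _ [M _ <-]; rewrite riskE; last exact: measurable_efron_morris.
  under eq_integral do rewrite -mulmxBl.
  exact: efron_morris_risk_le.
apply: le_ereal_inf_tmp => _ [delta mdelta <-].
have supP M : (\int[mu M]_A (sqnorm (delta A *m c - M *m c))%:E <= sup_risk P X delta c)%E.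
  by rewrite -riskE//; apply: ereal_sup_ubound; exists M.
have mg : mxmeasurable (fun A => delta A *m c).
  apply: mxmeasurableM; last exact: mxmeasurable_cst.
  by move=> i j; exact: (measurableT_comp (measurable_mx_entry (i, j)) mdelta).
(* The lower bound concerns a finite worst-case risk; [+oo] is immediate, and [-oo] is impossible
   because risks are nonnegative. *)
case: (sup_risk P X delta c) supP => [r supP| |supP].
- by rewrite lee_fin; exact: (minimax_lower_bound mu_law mg supP).
- by rewrite leey.
- have : (0 <= (-oo : \bar R))%E.
    apply: le_trans (supP 0); apply: integral_ge0 => A _.
    by rewrite lee_fin sqnorm_ge0.
  by [].
Qed.
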